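(* There are constants $c\ge0$ and $C$ and an algorithm that, given any string $x$ and integers $k,\alpha_0$ with $K(x)\le k\le\lambda_x(\alpha_0)$, finds a non-increasing function $\lambda$ defined on $[0,k]$ such that $\lambda_x$ is $(\varepsilon,\delta)$-close to $\lambda$ with $\delta=\lambda_x(\alpha_0)-K(x)+C$ and $\varepsilon=\alpha_0-\alpha_1+c\log k$, where $\alpha_1=\min\{\alpha:\lambda_x(\alpha)\le k+c\log k\}$.
   Context: $K$ is prefix Kolmogorov complexity w.r.t. a fixed reference universal prefix machine. For a finite set $S$, $K(S)$ is the length of a shortest program listing $S$, $\Lambda(S)=K(S)+\log|S|$ (log base 2), and $\lambda_x(\alpha)=\min\{\Lambda(S): S\text{ finite},x\in S,K(S)\le\alpha\}$. Closeness: $f$ is $(\varepsilon(i),\delta(i))$-close to $g$ (functions on $\{0,\dots,k\}$ with values in $\mathbb N\cup\{\infty\}$) if for every $i\in[\varepsilon(0),k]$: $f(i)\ge\min\{g(j): j\in[\varepsilon(0),k],|j-i|\le\varepsilon(i)\}-\delta(i)$ and $f(i)\le\max\{g(j): j\in[\varepsilon(0),k],|j-i|\le\varepsilon(i)\}+\delta(i)$.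
   Formalization: The accuracy ε is taken as max(0, α_0−α_1+c log k): when α_0−α_1+c log k is negative, the windows |j−i|≤ε are empty and literal closeness fails for every λ; for nonnegative values nothing changes. *)

(* Defs.v *)
From HB Require Import structures.
From mathcomp Require Import all_boot all_order all_algebra finmap.
From mathcomp Require Import all_classical all_reals all_analysis.

Set Implicit Arguments.
Unset Strict Implicit.
Unset Printing Implicit Defensive.

Import Order.TTheory GRing.Theory Num.Theory.

(* Algorithms are programs of a point-free form of Jones' WHILE language: one
   memory cell holding a binary tree (an S-expression).  The language is Turing
   complete, and strings, numbers and lists are trees in a direct way. *)
Inductive tree : Type := Leaf | Node of tree & tree.

Definition hd (t : tree) : tree := if t is Node l _ then l else Leaf.
Definition tl (t : tree) : tree := if t is Node _ r then r else Leaf.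

Inductive program : Type :=
| CId
| CLeaf
| CHd
| CTl
| CNode of program & program
| CComp of program & program
| CIf of program & program & program
| CWhile of program & program.

(* [halts_with f a b]: started on a, the program f halts with result b. *)
Inductive halts_with : program -> tree -> tree -> Prop :=
| EvId a : halts_with CId a a
| EvLeaf a : halts_with CLeaf a Leaf
| EvHd a : halts_with CHd a (hd a)
| EvTl a : halts_with CTl a (tl a)
| EvNode f g a b c : halts_with f a b -> halts_with g a c -> halts_with (CNode f g) a (Node b c)
| EvComp f g a b c : halts_with g a b -> halts_with f b c -> halts_with (CComp f g) a c
| EvIfTrue t f g a l r b :
    halts_with t a (Node l r) -> halts_with f a b -> halts_with (CIf t f g) a b
| EvIfFalse t f g a b : halts_with t a Leaf -> halts_with g a b -> halts_with (CIf t f g) a b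
| EvWhileStop t f a : halts_with t a Leaf -> halts_with (CWhile t f) a a
| EvWhileStep t f a l r b c :
    halts_with t a (Node l r) -> halts_with f a b -> halts_with (CWhile t f) b c ->
    halts_with (CWhile t f) a c.

Definition tree_of_bool (b : bool) : tree := if b then Node Leaf Leaf else Leaf.
Definition tree_of_seq (A : Type) (e : A -> tree) (s : seq A) : tree :=
  foldr (fun a t => Node (e a) t) Leaf s.
Definition tree_of_nat (n : nat) : tree := iter n (Node Leaf) Leaf.
Definition tree_of_int (z : int) : tree :=
  match z with
  | Posz n => Node (tree_of_bool false) (tree_of_nat n)
  | Negz n => Node (tree_of_bool true) (tree_of_nat n)
  end.
Definition tree_of_option (A : Type) (e : A -> tree) (o : option A) : tree :=
  if o is Some a then Node Leaf (e a) else Leaf.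
Definition tree_of_string (x : bitseq) : tree := tree_of_seq tree_of_bool x.

Definition prefix_machine (V : program) : Prop :=
  forall (p q : bitseq) (a b : tree),
    halts_with V (tree_of_string p) a -> halts_with V (tree_of_string q) b ->
    prefix p q -> p = q.

(* Universality by adjunction: U simulates every prefix machine V after reading
   a string w that depends only on V. *)
Definition universal_prefix_machine (U : program) : Prop :=
  prefix_machine U /\
  forall V : program, prefix_machine V ->
    exists w : bitseq, forall (p : bitseq) (a : tree),
      halts_with U (tree_of_string (w ++ p)) a <-> halts_with V (tree_of_string p) a.

(* The program p, run on U, halts having printed the strings s, in order. *)
Definition prints (U : program) (p : bitseq) (s : seq bitseq) : Prop :=
  halts_with U (tree_of_string p) (tree_of_seq tree_of_string s).

Local Open Scope classical_set_scope.
Local Open Scope ring_scope.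
Local Open Scope ereal_scope.

(* The minima are written with ereal_inf: every infimum below is attained, and
   the minimum of the empty set is +oo. *)

(* A program for the string x is one that prints x and nothing else; in
   particular it also lists the set {x}. *)
Definition KC (R : realType) (U : program) (x : bitseq) : \bar R :=
  ereal_inf [set (size p)%:R%:E | p in [set p | prints U p [:: x]]].

Definition KC_set (R : realType) (U : program) (S : {fset bitseq}) : \bar R :=
  ereal_inf [set (size p)%:R%:E |
    p in [set p | exists s : seq bitseq, prints U p s /\ s =i S]].

Definition logb2 (R : realType) (r : R) : R := (ln r / ln 2)%R.

Definition Lambda (R : realType) (U : program) (S : {fset bitseq}) : \bar R :=
  KC_set R U S + (logb2 (#|` S|%fset)%:R)%:E.

Definition lambda (R : realType) (U : program) (x : bitseq) (alpha : int) : \bar R :=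
  ereal_inf [set Lambda R U S |
    S in [set S : {fset bitseq} | x \in S /\ KC_set R U S <= alpha%:~R%:E]].

Definition alpha1 (R : realType) (U : program) (c : R) (x : bitseq) (k : nat) :
    \bar R :=
  ereal_inf [set alpha%:~R%:E | alpha in
    [set alpha : int | lambda R U x alpha <= (k%:R + c * logb2 k%:R)%:E]].

Definition window (R : realType) (k : nat) (eps : nat -> \bar R) (i : nat) :
    set nat :=
  [set j | [/\ eps 0%N <= j%:R%:E, (j <= k)%N & `|j%:R - i%:R|%:E <= eps i]].

(* f is (eps(i), delta(i))-close to g; f and g matter only on {0, ..., k}. *)
Definition close_on (R : realType) (k : nat) (eps delta : nat -> \bar R)
    (f g : nat -> \bar R) : Prop :=
  forall i : nat, eps 0%N <= i%:R%:E -> (i <= k)%N ->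
    ereal_inf [set g j | j in window k eps i] - delta i <= f i /\
    f i <= ereal_sup [set g j | j in window k eps i] + delta i.

(* None stands for infinity. *)
Definition ereal_of_option (R : realType) (o : option nat) : \bar R :=
  if o is Some n then n%:R%:E else +oo.

(* The accuracy of the argument; it is a distance, so a negative value of
   alpha_0 - alpha_1 + c log k (possible when lambda_x(alpha_0) is much larger
   than k) is read as 0. *)
Definition epsilon_of (R : realType) (U : program) (c : R) (x : bitseq) (k : nat)
    (alpha0 : int) : \bar R :=
  maxe 0 (alpha0%:~R%:E - alpha1 U c x k + (c * logb2 k%:R)%:E).

Definition delta_of (R : realType) (U : program) (C : R) (x : bitseq) (alpha0 : int) :
    \bar R :=
  lambda R U x alpha0 - KC R U x + C%:E.

(* Main.v *)
Require Import Defs.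
From HB Require Import structures.
From mathcomp Require Import all_boot all_order all_algebra finmap.
From mathcomp Require Import all_classical all_reals all_analysis.
From mathcomp Require Import zify ring lra.

(* Let A wait until some program of length at most k is seen to print x alone,
   and let T be the time at which this happens.  For i < alpha_0 the algorithm
   outputs the approximation of lambda_x(i) from above that is known at time T,
   and for i >= alpha_0 it outputs k.

   The approximation can only be too large, and this happens at i only if a
   program q of length at most i halts after T.  In that case list the programs
   of length at most k in the order in which they halt, and cut the list into
   blocks of size 2^(k+1-i).  The block that contains the program of x is either
   complete when q halts, and then it is determined by its number (i bits), or
   it is the last one at that time, and then it is determined by q.  Hence x
   lies in a set of complexity i + O(log k) and logarithmic size at most
   k + 1 - i, so that alpha_1 <= i + O(log k).  Therefore min(alpha_0, k) is
   within epsilon of i, where the output is at most k <= lambda_x(alpha_0), while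
   lambda_x(i) >= K(x) - O(1) by two-part coding. *)

Set Implicit Arguments.
Unset Strict Implicit.
Unset Printing Implicit Defensive.

Import Order.TTheory GRing.Theory Num.Theory.

(** * Total functions computed by programs *)

(** The block size comes from counting: there are fewer than 2^(k+1) programs of length at most k,
    so blocks of size 2^(k+1-|q|) have numbers below 2^|q|. The number of a block and the program q
    are thus descriptions of the same length, and in K(S) + log|S| the length |q| cancels, leaving k
    + 1 plus overhead. As complexity is prefix complexity, a description must also tell where it
    ends and which k is meant; the self-delimiting fields for k and |q| are the source of the term c
    log k. The same c serves in alpha_1 and in epsilon, where its two contributions cancel. Each
    description is decoded by a concrete prefix machine, which universality turns into a program for
    [U] at constant cost. The decoders and the algorithm therefore have to be WHILE programs. Each
    is written as a total function of a time bound and an input, shown computable by composition,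
    and made partial by one unbounded search over the time bound. *)

Lemma halts_with_det f a b c : halts_with f a b -> halts_with f a c -> b = c.
Proof.
move=> H; elim: H c => {f a b} *;
  match goal with H : halts_with _ _ ?c |- _ = ?c => inversion H; subst end;
  repeat match goal with
  | IH : forall c, halts_with ?f ?a c -> ?b = c, H : halts_with ?f ?a ?d |- _ =>
      move: {H} (IH _ H) => H; try discriminate H; try subst d
  end; by [].
Qed.

Class encoding (A : Type) := encode : A -> tree.

Instance encoding_tree : encoding tree := id.
Instance encoding_unit : encoding unit := fun=> Leaf.
Instance encoding_bool : encoding bool := tree_of_bool.
Instance encoding_nat : encoding nat := tree_of_nat.
Instance encoding_int : encoding int := tree_of_int.
Instance encoding_seq (A : Type) (eA : encoding A) : encoding (seq A) :=
  tree_of_seq eA.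
Instance encoding_option (A : Type) (eA : encoding A) : encoding (option A) :=
  tree_of_option eA.
Instance encoding_prod (A B : Type) (eA : encoding A) (eB : encoding B) :
  encoding (A * B) := fun p => Node (eA p.1) (eB p.2).

(** Only total functions are covered; the decoders and the algorithm become partial through
    [unbounded_search]. *)
Definition computable (A B : Type) {eA : encoding A} {eB : encoding B}
    (f : A -> B) : Prop :=
  exists P, forall a, halts_with P (encode a) (encode (f a)).

Section Combinators.
Context {E : Type} {eE : encoding E}.

Lemma computable_id : computable (fun e : E => e).
Proof. by exists CId => a; constructor. Qed.

Lemma computable_const (A : Type) (eA : encoding A) (a : A) :
  computable (fun _ : E => a).
Proof.
have constP (t : tree) : exists P, forall b, halts_with P b t.
  elim: t => [|l [P HP] r [Q HQ]]; first by exists CLeaf; constructor.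
  by exists (CNode P Q) => b; constructor.
by have [P HP] := constP (encode a); exists P.
Qed.

Lemma computable_comp (A B : Type) (eA : encoding A) (eB : encoding B)
    (g : A -> B) (f : E -> A) :
  computable g -> computable f -> computable (fun e => g (f e)).
Proof.
by move=> [P HP] [Q HQ]; exists (CComp P Q) => e; apply: EvComp (HQ e) (HP _).
Qed.

(** The same program works, because a tree is its own code. *)
Lemma computable_encode (A : Type) (eA : encoding A) (f : E -> A) :
  computable f -> computable (fun e => encode (f e)).
Proof. by move=> [P HP]; exists P. Qed.

Lemma computable_pair (A B : Type) (eA : encoding A) (eB : encoding B)
    (f : E -> A) (g : E -> B) :
  computable f -> computable g -> computable (fun e => (f e, g e)).
Proof. by move=> [P HP] [Q HQ]; exists (CNode P Q) => e; constructor. Qed.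

Lemma computable_fst (A B : Type) (eA : encoding A) (eB : encoding B)
    (f : E -> A * B) : computable f -> computable (fun e => (f e).1).
Proof.
by move=> [P HP]; exists (CComp CHd P) => e; apply: EvComp (HP e) (EvHd _).
Qed.

Lemma computable_snd (A B : Type) (eA : encoding A) (eB : encoding B)
    (f : E -> A * B) : computable f -> computable (fun e => (f e).2).
Proof.
by move=> [P HP]; exists (CComp CTl P) => e; apply: EvComp (HP e) (EvTl _).
Qed.

Lemma computable_hd (f : E -> tree) : computable f -> computable (fun e => hd (f e)).
Proof.
by move=> [P HP]; exists (CComp CHd P) => e; apply: EvComp (HP e) (EvHd _).
Qed.

Lemma computable_tl (f : E -> tree) : computable f -> computable (fun e => tl (f e)).
Proof.
by move=> [P HP]; exists (CComp CTl P) => e; apply: EvComp (HP e) (EvTl _).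
Qed.

Lemma computable_Node (f g : E -> tree) :
  computable f -> computable g -> computable (fun e => Node (f e) (g e)).
Proof. by move=> [P HP] [Q HQ]; exists (CNode P Q) => e; constructor. Qed.

Lemma computable_if (A : Type) (eA : encoding A) (b : E -> bool) (f g : E -> A) :
  computable b -> computable f -> computable g ->
  computable (fun e => if b e then f e else g e).
Proof.
move=> [P HP] [Q HQ] [S HS]; exists (CIf P Q S) => e.
by move: (HP e); case: (b e) => H; [apply: EvIfTrue H _ | apply: EvIfFalse].
Qed.

Lemma computable_cons (A : Type) (eA : encoding A) (f : E -> A) (g : E -> seq A) :
  computable f -> computable g -> computable (fun e => f e :: g e).
Proof. by move=> [P HP] [Q HQ]; exists (CNode P Q) => e; constructor. Qed.

Lemma computable_behead (A : Type) (eA : encoding A) (f : E -> seq A) :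
  computable f -> computable (fun e => behead (f e)).
Proof.
move=> [P HP]; exists (CComp CTl P) => e; apply: EvComp (HP e) _.
by case: (f e) => [|a s]; apply: EvTl.
Qed.

Lemma computable_head (A : Type) (eA : encoding A) (a : E -> A) (f : E -> seq A) :
  computable a -> computable f -> computable (fun e => head (a e) (f e)).
Proof.
move=> [Q HQ] [P HP]; exists (CIf P (CComp CHd P) Q) => e.
move: (HP e); case: (f e) => [|b s] H; first exact: EvIfFalse.
by apply: EvIfTrue (H) _; apply: EvComp (H) _; apply: EvHd.
Qed.

Lemma computable_succn (f : E -> nat) : computable f -> computable (fun e => (f e).+1).
Proof. by move=> [P HP]; exists (CNode CLeaf P) => e; constructor; first constructor. Qed.

Lemma computable_predn (f : E -> nat) : computable f -> computable (fun e => (f e).-1).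
Proof.
move=> [P HP]; exists (CComp CTl P) => e; apply: EvComp (HP e) _.
by case: (f e) => [|n]; apply: EvTl.
Qed.

Lemma computable_eqn0 (f : E -> nat) : computable f -> computable (fun e => f e == 0).
Proof.
move=> [P HP]; exists (CIf P CLeaf (CNode CLeaf CLeaf)) => e.
move: (HP e); case: (f e) => [|n] H; first by apply: EvIfFalse => //; do !constructor.
by apply: EvIfTrue H _; constructor.
Qed.

Lemma computable_Some (A : Type) (eA : encoding A) (f : E -> A) :
  computable f -> computable (fun e => Some (f e)).
Proof. by move=> [P HP]; exists (CNode CLeaf P) => e; constructor; first constructor. Qed.

Lemma computable_match_option (A B : Type) (eA : encoding A) (eB : encoding B)
    (f : E -> option A) (g : E -> A -> B) (h : E -> B) :
  computable f -> computable (fun p : E * A => g p.1 p.2) -> computable h ->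
  computable (fun e => if f e is Some a then g e a else h e).
Proof.
move=> [P HP] [Q HQ] [S HS].
exists (CIf P (CComp Q (CNode CId (CComp CTl P))) S) => e.
move: (HP e); case: (f e) => [a|] H; last exact: EvIfFalse.
apply: EvIfTrue (H) _; apply: EvComp _ (HQ (e, a)).
by constructor; [constructor | apply: EvComp (H) _; apply: EvTl].
Qed.

Definition is_Node (t : tree) : bool := if t is Node _ _ then true else false.

Lemma computable_is_Node (f : E -> tree) :
  computable f -> computable (fun e => is_Node (f e)).
Proof.
move=> [P HP]; exists (CIf P (CNode CLeaf CLeaf) CLeaf) => e.
move: (HP e); case: (f e) => [|l r] H; first by apply: EvIfFalse => //; do !constructor.
by apply: EvIfTrue H _; do !constructor.
Qed.

(** All bounded recursion used later, arithmetic included, is reduced to this one loop. *)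
Lemma computable_foldl (A B : Type) (eA : encoding A) (eB : encoding B)
    (g : E -> B -> A -> B) (z : E -> B) (s : E -> seq A) :
  computable (fun p : E * (B * A) => g p.1 p.2.1 p.2.2) ->
  computable z -> computable s -> computable (fun e => foldl (g e) (z e) (s e)).
Proof.
move=> [G HG] [Z HZ] [S HS].
(* The loop state holds the remaining list, then the input, then the accumulator. Its head is [Leaf]
   exactly when the list is empty, so [CHd] serves as the test. *)
pose env := CComp CHd CTl.
pose body := CNode (CComp CTl CHd)
  (CNode env (CComp G (CNode env (CNode (CComp CTl CTl) (CComp CHd CHd))))).
exists (CComp (CComp CTl CTl) (CComp (CWhile CHd body) (CNode S (CNode CId Z)))) => e.
apply: (@EvComp _ _ _ (Node Leaf (Node (encode e) (encode (foldl (g e) (z e) (s e)))))).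
  2: by apply: EvComp; apply: EvTl.
apply: EvComp; first by constructor; [exact: HS | constructor; [constructor | exact: HZ]].
elim: (s e) (z e) => [|a l IH] b /=; first by apply: EvWhileStop; apply: EvHd.
apply: EvWhileStep (IH (g e b a)).
  exact: (EvHd (Node (Node (encode a) (encode l)) (Node (encode e) (encode b)))).
constructor; first by apply: EvComp; [apply: EvHd | apply: EvTl].
constructor; first by apply: EvComp; [apply: EvTl | apply: EvHd].
apply: EvComp _ (HG (e, (b, a))).
constructor; first by apply: EvComp; [apply: EvTl | apply: EvHd].
constructor; first by apply: EvComp; [apply: EvTl | apply: EvTl].
by apply: EvComp; apply: EvHd.
Qed.

End Combinators.

(* The loop counts T in unary next to the input until h T a is defined. *)
Lemma unbounded_search (A : Type) (eA : encoding A) (h : nat -> A -> option tree) :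
  computable (fun p : nat * A => h p.1 p.2) ->
  exists V, forall a b, halts_with V (encode a) b <->
    exists2 T, h T a = Some b & forall T', T' < T -> h T' a = None.
Proof.
move=> [P HP].
pose test := CIf P CLeaf (CNode CLeaf CLeaf).
pose next := CNode (CNode CLeaf CHd) CTl.
exists (CComp (CComp CTl P) (CComp (CWhile test next) (CNode CLeaf CId))) => a b.
have testE T v : halts_with test (encode (T, a)) v ->
    v = if h T a is Some _ then Leaf else Node Leaf Leaf.
  move=> /halts_with_det; apply; rewrite /test.
  move: (HP (T, a)) => /=; case: (h T a) => [c|] H;
    last by apply: EvIfFalse => //; do !constructor.
  by apply: EvIfTrue H _; constructor.
have testH T : halts_with test (encode (T, a))
    (if h T a is Some _ then Leaf else Node Leaf Leaf).
  rewrite /test.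
  move: (HP (T, a)) => /=; case: (h T a) => [c|] H;
    last by apply: EvIfFalse => //; do !constructor.
  by apply: EvIfTrue H _; constructor.
have nextH T : halts_with next (encode (T, a)) (encode (T.+1, a)).
  constructor; last exact: (EvTl (encode (T, a))).
  by constructor; [constructor | exact: (EvHd (encode (T, a)))].
have loopH n T : (forall T', T <= T' < T + n -> h T' a = None) -> h (T + n) a <> None ->
    halts_with (CWhile test next) (encode (T, a)) (encode (T + n, a)).
  elim: n T => [|n IH] T H1 H2.
    rewrite addn0 in H2 *; apply: EvWhileStop.
    by move: (testH T); case: (h T a) H2.
  apply: (@EvWhileStep _ _ _ Leaf Leaf _ _ _ (nextH T)).
    by move: (testH T); rewrite H1 // leqnn -addSnnS leq_addr.
  rewrite -addSnnS; apply: IH; last by rewrite addSnnS.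
  by move=> T' /andP[/ltnW HT HT']; apply: H1; rewrite HT -addSnnS.
(* Conversely, a halting derivation of the loop is finite, so some counter value passes the test.
   Program and state are generalised to allow induction on the derivation. *)
have loopV f s c : halts_with f s c -> f = CWhile test next -> forall T, s = encode (T, a) ->
    exists n, h (T + n) a <> None.
  elim=> // {f s c}.
    move=> t f s Ht _ [Et _] T Es; rewrite {}Et {}Es in Ht; exists 0; rewrite addn0.
    by move: (testE _ _ Ht); case: (h T a).
  move=> t f s l r s' c Ht _ Hf _ _ IH [Et Ef] T Es.
  rewrite {}Et {}Ef {}Es in Hf IH.
  have [|n Hn] := IH erefl T.+1; first exact: halts_with_det Hf (nextH T).
  by exists n.+1; rewrite -addSnnS.
have total T c : h T a = Some c -> (forall T', T' < T -> h T' a = None) ->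
    halts_with (CComp (CComp CTl P) (CComp (CWhile test next) (CNode CLeaf CId))) (encode a) c.
  move=> H1 H2; apply: (@EvComp _ _ _ (encode (T, a))).
    apply: EvComp; first by constructor; constructor.
    apply: (loopH T 0) => [T' /=|]; last by rewrite add0n H1.
    by rewrite add0n; apply: H2.
  apply: EvComp; first exact: (HP (T, a)).
  by rewrite /= H1; apply: EvTl.
split=> [H | [T H1 H2]]; last exact: total H1 H2.
have [n Hn] : exists n, h n a.
  inversion H as [| | | | |? ? ? s1 ? Hl Hr| | | |]; subst.
  inversion Hl as [| | | | |? ? ? s2 ? Hi Hw| | | |]; subst.
  have Es2 : s2 = encode (0, a).
    by apply: (halts_with_det Hi); constructor; constructor.
  rewrite {}Es2 in Hi Hw.
  have [n] := loopV _ _ _ Hw erefl 0 erefl.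
  by rewrite add0n; exists n; case: (h n a) p.
have [T HT Tmin] := ex_minnP (ex_intro (fun n => isSome (h n a)) n Hn).
have Tm T' : T' < T -> h T' a = None.
  by case E: (h T' a) => // HT'; have := Tmin T'; rewrite E => /(_ erefl); rewrite leqNgt HT'.
case E: (h T a) HT => [c|] // _.
by exists T => //; rewrite E (halts_with_det H (total _ _ E Tm)).
Qed.

Ltac computability_core :=
  cbv beta; lazymatch goal with
  | |- computable (fun _ => ?c) => apply computable_const
  | |- computable (fun e => e) => apply computable_id
  | |- computable (fun e => (@?f e).1) => apply (computable_fst (f := f))
  | |- computable (fun e => (@?f e).2) => apply (computable_snd (f := f))
  | |- computable (fun e => (@?f e, @?g e)) => apply (computable_pair (f := f) (g := g))
  | |- computable (fun e => @?f e :: @?g e) => apply (computable_cons (f := f) (g := g))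
  | |- computable (fun e => Some (@?f e)) => apply (computable_Some (f := f))
  | |- computable (fun e => (@?f e).+1) => apply (computable_succn (f := f))
  | |- computable id => apply computable_id
  | |- computable fst => apply (computable_fst computable_id)
  | |- computable snd => apply (computable_snd computable_id)
  end.
Ltac computability := repeat first [assumption | computability_core | apply computable_if].

(** * Logic, lists and arithmetic as computable functions *)

Section BasicFunctions.
Context {E : Type} {eE : encoding E}.

Lemma eq_computable (A : Type) (eA : encoding A) (f g : E -> A) :
  f =1 g -> computable g -> computable f.
Proof. by move=> fg [P HP]; exists P => e; rewrite fg. Qed.

Lemma computable_negb (f : E -> bool) : computable f -> computable (fun e => ~~ f e).
Proof.
move=> Hf; apply: (@eq_computable _ _ _ (fun e => if f e then false else true)) => [e|].
  by case: (f e).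
by apply: computable_if => //; apply: computable_const.
Qed.

Lemma computable_andb (f g : E -> bool) :
  computable f -> computable g -> computable (fun e => f e && g e).
Proof.
move=> Hf Hg; apply: (@eq_computable _ _ _ (fun e => if f e then g e else false)) => [//|].
by apply: computable_if => //; apply: computable_const.
Qed.

Lemma computable_orb (f g : E -> bool) :
  computable f -> computable g -> computable (fun e => f e || g e).
Proof.
move=> Hf Hg; apply: (@eq_computable _ _ _ (fun e => if f e then true else g e)) => [//|].
by apply: computable_if => //; apply: computable_const.
Qed.

Lemma computable_eqb (f g : E -> bool) :
  computable f -> computable g -> computable (fun e => f e == g e).
Proof.
move=> Hf Hg; apply: (@eq_computable _ _ _ (fun e => if f e then g e else ~~ g e)) => [e|].
  by case: (f e); case: (g e).
by apply: computable_if => //; apply: computable_negb.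
Qed.

Lemma computable_isSome (A : Type) (eA : encoding A) (f : E -> option A) :
  computable f -> computable (fun e => isSome (f e)).
Proof.
move=> Hf; apply: (@computable_match_option _ _ _ _ _ _ _ (fun _ _ => true)
  (fun _ => false)) => //; exact: computable_const.
Qed.

Lemma computable_rev (A : Type) (eA : encoding A) (s : E -> seq A) :
  computable s -> computable (fun e => rev (s e)).
Proof.
move=> Hs.
apply: (@eq_computable _ _ _ (fun e => foldl (fun t a => a :: t) [::] (s e))) => [e|].
  by rewrite /rev; elim: (s e) [::] => //= a l IH t.
apply: (computable_foldl (g := fun _ t a => a :: t)) => //; last exact: computable_const.
by apply: computable_cons; [do 2 apply: computable_snd
  | apply: computable_fst; apply: computable_snd]; apply: computable_id.
Qed.

Lemma computable_foldr (A B : Type) (eA : encoding A) (eB : encoding B)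
    (g : E -> A -> B -> B) (z : E -> B) (s : E -> seq A) :
  computable (fun p : E * (A * B) => g p.1 p.2.1 p.2.2) ->
  computable z -> computable s -> computable (fun e => foldr (g e) (z e) (s e)).
Proof.
move=> [G HG] Hz Hs.
apply: (@eq_computable _ _ _ (fun e => foldl (fun b a => g e a b) (z e) (rev (s e)))) => [e|].
  by rewrite foldl_rev.
apply: (computable_foldl (g := fun e b a => g e a b)) => //; last exact: computable_rev.
apply: (@computable_comp _ _ _ _ _ _ (fun p : E * (A * B) => g p.1 p.2.1 p.2.2)
  (fun p : E * (B * A) => (p.1, (p.2.2, p.2.1)))); first by exists G.
by computability.
Qed.

End BasicFunctions.

Section ListFunctions.
Context {E : Type} {eE : encoding E}.

Lemma computable_map (A B : Type) (eA : encoding A) (eB : encoding B)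
    (f : E -> A -> B) (s : E -> seq A) :
  computable (fun p : E * A => f p.1 p.2) -> computable s ->
  computable (fun e => map (f e) (s e)).
Proof.
move=> Hf Hs; apply: (@computable_foldr _ _ _ _ _ _
  (fun e a t => f e a :: t) (fun _ => [::])) => //.
  2: exact: computable_const.
apply: computable_cons; last by computability.
by apply: (computable_comp (f := fun p : E * (A * seq B) => (p.1, p.2.1)) Hf); computability.
Qed.

Lemma computable_filter (A : Type) (eA : encoding A) (f : E -> A -> bool) (s : E -> seq A) :
  computable (fun p : E * A => f p.1 p.2) -> computable s ->
  computable (fun e => [seq a <- s e | f e a]).
Proof.
move=> Hf Hs.
apply: (@computable_foldr _ _ _ _ _ _
  (fun e a t => if f e a then a :: t else t) (fun _ => [::])) => //.
  2: exact: computable_const.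
apply: computable_if; [|by computability|by computability].
by apply: (computable_comp (f := fun p : E * (A * seq A) => (p.1, p.2.1)) Hf); computability.
Qed.

Lemma computable_has (A : Type) (eA : encoding A) (f : E -> A -> bool) (s : E -> seq A) :
  computable (fun p : E * A => f p.1 p.2) -> computable s ->
  computable (fun e => has (f e) (s e)).
Proof.
move=> Hf Hs.
apply: (@computable_foldr _ _ _ _ _ _ (fun e a b => f e a || b) (fun _ => false)) => //.
  2: exact: computable_const.
apply: computable_orb; last by computability.
by apply: (computable_comp (f := fun p : E * (A * bool) => (p.1, p.2.1)) Hf); computability.
Qed.

Lemma computable_find (A : Type) (eA : encoding A) (f : E -> A -> bool) (s : E -> seq A) :
  computable (fun p : E * A => f p.1 p.2) -> computable s ->
  computable (fun e => find (f e) (s e)).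
Proof.
move=> Hf Hs.
apply: (@computable_foldr _ _ _ _ _ _ (fun e a n => if f e a then 0 else n.+1) (fun _ => 0)) => //.
  2: exact: computable_const.
apply: computable_if; [|by computability|by computability].
by apply: (computable_comp (f := fun p : E * (A * nat) => (p.1, p.2.1)) Hf); computability.
Qed.

Lemma computable_pmap (A B : Type) (eA : encoding A) (eB : encoding B)
    (f : E -> A -> option B) (s : E -> seq A) :
  computable (fun p : E * A => f p.1 p.2) -> computable s ->
  computable (fun e => pmap (f e) (s e)).
Proof.
move=> Hf Hs.
apply: (@eq_computable _ _ _ _ _
  (fun e => foldr (fun a t => if f e a is Some b then b :: t else t) [::] (s e))) => [e|].
  by elim: (s e) => //= a l ->; case: (f e a).
apply: (@computable_foldr _ _ _ _ _ _ (fun e a t => if f e a is Some b then b :: t else t)) => //.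
  2: exact: computable_const.
apply: (@computable_match_option _ _ _ _ _ _ _ (fun (p : E * (A * seq B)) b => b :: p.2.2)).
  by apply: (computable_comp (f := fun p : E * (A * seq B) => (p.1, p.2.1)) Hf); computability.
all: by computability.
Qed.

Lemma computable_cat (A : Type) (eA : encoding A) (s t : E -> seq A) :
  computable s -> computable t -> computable (fun e => s e ++ t e).
Proof.
move=> Hs Ht.
apply: (@eq_computable _ _ _ _ _ (fun e => foldr (fun a l => a :: l) (t e) (s e))) => [e|].
  by elim: (s e) => //= a l ->.
by apply: (@computable_foldr _ _ _ _ _ _ (fun _ a l => a :: l)) => //; computability.
Qed.

Lemma computable_size (A : Type) (eA : encoding A) (s : E -> seq A) :
  computable s -> computable (fun e => size (s e)).
Proof.
move=> Hs; apply: (@eq_computable _ _ _ _ _ (fun e => foldr (fun _ => succn) 0 (s e))) => [e|].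
  by elim: (s e) => //= a l ->.
by apply: (@computable_foldr _ _ _ _ _ _ (fun _ _ => succn)) => //; computability.
Qed.

Lemma computable_iter (B : Type) (eB : encoding B) (n : E -> nat) (f : E -> B -> B) (z : E -> B) :
  computable n -> computable (fun p : E * B => f p.1 p.2) -> computable z ->
  computable (fun e => iter (n e) (f e) (z e)).
Proof.
move=> [P HP] Hf Hz.
apply: (@eq_computable _ _ _ _ _ (fun e => foldr (fun _ => f e) (z e) (nseq (n e) tt))) => [e|].
  by elim: (n e) => //= m ->.
apply: (@computable_foldr _ _ _ _ _ _ (fun e _ => f e)) => //.
  by apply: (computable_comp (f := fun p : E * (unit * B) => (p.1, p.2.2)) Hf); computability.
(* A number has the same code as a list of that many units, so the program for [n] also produces the
   list to fold over. *)
exists P => e; have -> // : encode (nseq (n e) tt) = encode (n e).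
by elim: (n e) => //= m IH; congr Node.
Qed.

Lemma computable_addn (f g : E -> nat) :
  computable f -> computable g -> computable (fun e => f e + g e).
Proof.
move=> Hf Hg; apply: (@eq_computable _ _ _ _ _ (fun e => iter (f e) succn (g e))) => [e|].
  by elim: (f e) => //= m <-.
by apply: (computable_iter (f := fun _ => succn)) => //; computability.
Qed.

Lemma computable_subn (f g : E -> nat) :
  computable f -> computable g -> computable (fun e => f e - g e).
Proof.
move=> Hf Hg; apply: (@eq_computable _ _ _ _ _ (fun e => iter (g e) predn (f e))) => [e|].
  by elim: (g e) => [|m /= <-]; rewrite ?subn0 ?subnS.
apply: (computable_iter (f := fun _ => predn)) => //.
by apply: computable_predn; computability.
Qed.

Lemma computable_leq (f g : E -> nat) :
  computable f -> computable g -> computable (fun e => f e <= g e).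
Proof. by move=> Hf Hg; apply: computable_eqn0; apply: computable_subn. Qed.

Lemma computable_eqn (f g : E -> nat) :
  computable f -> computable g -> computable (fun e => f e == g e).
Proof.
move=> Hf Hg; apply: (@eq_computable _ _ _ _ _ (fun e => (f e <= g e) && (g e <= f e))) => [e|].
  exact: eqn_leq.
by apply: computable_andb; apply: computable_leq.
Qed.

Lemma computable_minn (f g : E -> nat) :
  computable f -> computable g -> computable (fun e => minn (f e) (g e)).
Proof.
by move=> Hf Hg; apply: computable_if => //; apply: computable_leq => //; apply: computable_succn.
Qed.

Lemma computable_drop (A : Type) (eA : encoding A) (n : E -> nat) (s : E -> seq A) :
  computable n -> computable s -> computable (fun e => drop (n e) (s e)).
Proof.
move=> Hn Hs; apply: (@eq_computable _ _ _ _ _ (fun e => iter (n e) behead (s e))) => [e|].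
  elim: (n e) (s e) => [|m IH] l; first by rewrite drop0.
  by rewrite iterSr -IH; case: l => //=; case: m {IH}.
apply: (computable_iter (f := fun _ => behead)) => //.
by apply: computable_behead; computability.
Qed.

Lemma computable_take (A : Type) (eA : encoding A) (n : E -> nat) (s : E -> seq A) :
  computable n -> computable s -> computable (fun e => take (n e) (s e)).
Proof.
move=> Hn Hs.
apply: (@eq_computable _ _ _ _ _ (fun e => rev (drop (size (s e) - n e) (rev (s e))))) => [e|].
  by rewrite -(size_rev (s e)) -take_rev revK.
apply: computable_rev; apply: computable_drop; last exact: computable_rev.
by apply: computable_subn => //; apply: computable_size.
Qed.

Lemma computable_nth (A : Type) (eA : encoding A) (a : E -> A) (s : E -> seq A) (n : E -> nat) :
  computable a -> computable s -> computable n -> computable (fun e => nth (a e) (s e) (n e)).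
Proof.
move=> Ha Hs Hn.
apply: (@eq_computable _ _ _ _ _ (fun e => head (a e) (drop (n e) (s e)))) => [e|].
  by rewrite -nth0 nth_drop addn0.
by apply: computable_head => //; apply: computable_drop.
Qed.

End ListFunctions.

Section NumberFunctions.
Context {E : Type} {eE : encoding E}.

Lemma computable_muln (f g : E -> nat) :
  computable f -> computable g -> computable (fun e => f e * g e).
Proof.
move=> Hf Hg; apply: (@eq_computable _ _ _ _ _ (fun e => iter (f e) (addn (g e)) 0)) => [e|].
  by elim: (f e) => //= m <-; rewrite mulSn.
apply: (computable_iter (f := fun e => addn (g e))) => //; last exact: computable_const.
apply: computable_addn; last by computability.
by apply: (computable_comp Hg); computability.
Qed.

Lemma computable_exp2n (f : E -> nat) : computable f -> computable (fun e => 2 ^ f e).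
Proof.
move=> Hf; apply: (@eq_computable _ _ _ _ _ (fun e => iter (f e) (fun m => m + m) 1)) => [e|].
  by elim: (f e) => //= m <-; rewrite expnS mul2n addnn.
apply: (computable_iter (f := fun _ m => m + m)) => //; last exact: computable_const.
by apply: computable_addn; computability.
Qed.

Lemma computable_iota0 (n : E -> nat) : computable n -> computable (fun e => iota 0 (n e)).
Proof.
move=> Hn.
apply: (@eq_computable _ _ _ _ _ (fun e => iter (n e) (fun s => 0 :: map succn s) [::])) => [e|].
  by elim: (n e) => //= m <-; rewrite (iotaDl 1 0 m).
apply: (computable_iter (f := fun _ s => 0 :: map succn s)) => //; last exact: computable_const.
apply: computable_cons; first exact: computable_const.
by apply: (computable_map (f := fun _ => succn)); computability.
Qed.

Lemma computable_eq_bitseq (s t : E -> seq bool) :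
  computable s -> computable t -> computable (fun e => s e == t e).
Proof.
move=> Hs Ht.
apply: (@eq_computable _ _ _ _ _ (fun e => (size (s e) == size (t e)) &&
  ~~ has (fun i => nth false (s e) i != nth false (t e) i) (iota 0 (size (s e))))) => [e|].
  apply/eqP/andP => [->|[/eqP Hsz /hasPn H]].
    by split=> //; apply/hasPn => i _ /=; rewrite eqxx.
  apply: (eq_from_nth (x0 := false)) => // i Hi.
  by apply/eqP; rewrite -[_ == _]negbK; apply: H; rewrite mem_iota.
apply: computable_andb; first by apply: computable_eqn; apply: computable_size.
apply: computable_negb.
apply: (computable_has (f := fun e i => nth false (s e) i != nth false (t e) i)).
  2: by apply: computable_iota0; apply: computable_size.
apply: computable_negb; apply: computable_eqb; apply: computable_nth;
  try by computability.
  by apply: (computable_comp Hs); computability.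
by apply: (computable_comp Ht); computability.
Qed.

End NumberFunctions.

Lemma computable_mem_bitseq {E : Type} {eE : encoding E} (x : E -> seq bool)
    (s : E -> seq (seq bool)) :
  computable x -> computable s -> computable (fun e => x e \in s e).
Proof.
move=> Hx Hs.
apply: (@eq_computable _ _ _ _ _ (fun e => has (fun y => y == x e) (s e))) => [e|].
  by rewrite -has_pred1.
apply: (computable_has (f := fun e y => y == x e)) => //.
apply: (computable_eq_bitseq (s := fun p : E * seq bool => p.2)
  (t := fun p : E * seq bool => x p.1)).
  by computability.
by apply: (computable_comp Hx); computability.
Qed.

Lemma computable_undup_bitseq {E : Type} {eE : encoding E} (s : E -> seq (seq bool)) :
  computable s -> computable (fun e => undup (s e)).
Proof.
move=> Hs.
apply: (@eq_computable _ _ _ _ _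
  (fun e => foldr (fun x t => if x \in t then t else x :: t) [::] (s e))) => [e|].
  by elim: (s e) => //= a l <-; rewrite mem_undup.
apply: (computable_foldr (g := fun _ x t => if x \in t then t else x :: t)) => //.
  2: exact: computable_const.
by apply: computable_if; [apply: computable_mem_bitseq| |]; computability.
Qed.

Ltac computability_lib :=
  cbv beta; lazymatch goal with
  | |- computable (fun e => @?f e == 0) => apply (computable_eqn0 (f := f))
  | |- computable (fun e => @?f e == @?g e) => first
      [ apply (computable_eqn (f := f) (g := g)) | apply (computable_eqb (f := f) (g := g))
      | apply (computable_eq_bitseq (s := f) (t := g)) ]
  | |- computable (fun e => @?f e <= @?g e) => apply (computable_leq (f := f) (g := g))
  | |- computable (fun e => @?f e + @?g e) => apply (computable_addn (f := f) (g := g))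
  | |- computable (fun e => @?f e - @?g e) => apply (computable_subn (f := f) (g := g))
  | |- computable (fun e => @?f e * @?g e) => apply (computable_muln (f := f) (g := g))
  | |- computable (fun e => 2 ^ @?f e) => apply (computable_exp2n (f := f))
  | |- computable (fun e => minn (@?f e) (@?g e)) => apply (computable_minn (f := f) (g := g))
  | |- computable (fun e => ~~ @?f e) => apply (computable_negb (f := f))
  | |- computable (fun e => @?f e && @?g e) => apply (computable_andb (f := f) (g := g))
  | |- computable (fun e => @?f e || @?g e) => apply (computable_orb (f := f) (g := g))
  | |- computable (fun e => isSome (@?f e)) => apply (computable_isSome (f := f))
  | |- computable (fun e => size (@?f e)) => apply (computable_size (s := f))
  | |- computable (fun e => @?f e ++ @?g e) => apply (computable_cat (s := f) (t := g))
  | |- computable (fun e => take (@?f e) (@?g e)) => apply (computable_take (n := f) (s := g))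
  | |- computable (fun e => drop (@?f e) (@?g e)) => apply (computable_drop (n := f) (s := g))
  | |- computable (fun e => nth (@?a e) (@?s e) (@?n e)) =>
      apply (computable_nth (a := a) (s := s) (n := n))
  | |- computable (fun e => head (@?f e) (@?g e)) => apply (computable_head (a := f) (f := g))
  | |- computable (fun e => behead (@?f e)) => apply (computable_behead (f := f))
  | |- computable (fun e => iota 0 (@?f e)) => apply (computable_iota0 (n := f))
  | |- computable (fun e => undup (@?f e)) => apply (computable_undup_bitseq (s := f))
  | |- computable (fun e => hd (@?f e)) => apply (computable_hd (f := f))
  | |- computable (fun e => tl (@?f e)) => apply (computable_tl (f := f))
  | |- computable (fun e => Node (@?f e) (@?g e)) => apply (computable_Node (f := f) (g := g))
  | |- computable (fun e => is_Node (@?f e)) => apply (computable_is_Node (f := f))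
  | |- computable (fun e => @?x e \in @?s e) => apply (computable_mem_bitseq (x := x) (s := s))
  | |- computable (fun e => @?f e) => fail
  | |- @computable ?A ?B ?eA ?eB ?f => change (@computable A B eA eB (fun e => f e))
  end.
Ltac computability ::=
  repeat first [assumption | computability_core | computability_lib | apply computable_if].

(** * Recognising the codes of lists of strings *)

Section Decoding.

(** Every tree is literally the code of its spine as a list of trees, so the identity computes
    [spine] and a fold can traverse an arbitrary tree. *)
Fixpoint spine (t : tree) : seq tree := if t is Node l r then l :: spine r else [::].

Lemma computable_spine {E : Type} {eE : encoding E} (f : E -> tree) :
  computable f -> computable (fun e => spine (f e)).
Proof.
move=> [P HP]; exists P => e; have -> // : encode (spine (f e)) = f e.
by elim: (f e) => //= l _ r IH; congr Node.
Qed.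

Definition decode_bool (t : tree) : option bool :=
  if is_Node t then if is_Node (hd t) || is_Node (tl t) then None else Some true
  else Some false.

Definition decode_seq (A : Type) (d : tree -> option A) (t : tree) : option (seq A) :=
  foldr (fun a o => if o is Some l then if d a is Some b then Some (b :: l) else None else None)
    (Some [::]) (spine t).

(** A program of [U] may halt with a tree that codes no list of strings; [None] marks this case. *)
Definition decode_strings : tree -> option (seq (seq bool)) :=
  decode_seq (decode_seq decode_bool).

Lemma decode_boolP t b : decode_bool t = Some b <-> t = tree_of_bool b.
Proof.
by case: t b => [|[|? ?] [|? ?]] []; split.
Qed.

Lemma decode_seqP (A : Type) (d : tree -> option A) (e : A -> tree) :
  (forall t a, d t = Some a <-> t = e a) ->
  forall t s, decode_seq d t = Some s <-> t = tree_of_seq e s.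
Proof.
move=> dP t; elim: t => [|l _ r IH] s; first by case: s => [|a s]; split.
rewrite /decode_seq /= -/(decode_seq d r).
split.
  case Er: (decode_seq d r) => [s'|] //; case El: (d l) => [a|] // [<-] /=.
  by congr Node; [exact: (proj1 (dP _ _) El) | exact: (proj1 (IH _) Er)].
case: s => // a s [El Er]; have Er' : decode_seq d r = Some s by apply/IH.
by rewrite Er' (proj2 (dP l a) El).
Qed.

Lemma decode_stringsP t s :
  decode_strings t = Some s <-> t = tree_of_seq tree_of_string s.
Proof. by apply: decode_seqP => {}t x; apply: decode_seqP; apply: decode_boolP. Qed.

Lemma computable_decode_seq {E : Type} {eE : encoding E} (A : Type) (eA : encoding A)
    (d : tree -> option A) (f : E -> tree) :
  computable d -> computable f -> computable (fun e => decode_seq d (f e)).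
Proof.
move=> Hd Hf.
apply: (@computable_foldr _ _ _ _ _ _
  (fun _ a o => if o is Some l then if d a is Some b then Some (b :: l) else None else None)).
- apply: (@computable_match_option _ _ _ _ _ _ _
    (fun (p : E * (tree * option (seq A))) l => if d p.2.1 is Some b then Some (b :: l) else None)).
  + by computability.
  + apply: (@computable_match_option _ _ _ _ _ _
     (fun p : E * (tree * option (seq A)) * seq A => d p.1.2.1) (fun p b => Some (b :: p.2))).
    * by apply: computable_comp Hd _; computability.
    * by computability.
    * exact: computable_const.
  + exact: computable_const.
- exact: computable_const.
- exact: computable_spine.
Qed.

Lemma computable_decode_strings {E : Type} {eE : encoding E} (f : E -> tree) :
  computable f -> computable (fun e => decode_strings (f e)).
Proof.
apply: computable_decode_seq.
apply: (computable_decode_seq (f := id)); last exact: computable_id.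
by rewrite /decode_bool; computability.
Qed.

End Decoding.

(** * Evaluation with a time bound *)

Section ClockedEvaluation.

(* One round of a while loop; the flag records that the loop has stopped, and
   None that the test or the body did not stop in time. *)
Definition while_round (test body : tree -> option tree) (s : bool * option tree) :
    bool * option tree :=
  if s.1 then s else
  if s.2 is Some a then
    if test a is Some v then if is_Node v then (false, body a) else (true, Some a)
    else (false, None)
  else s.

(* The fuel n bounds the number of rounds of every loop. *)
Fixpoint run (f : program) (n : nat) (a : tree) : option tree :=
  match f with
  | CId => Some a
  | CLeaf => Some Leaf
  | CHd => Some (hd a)
  | CTl => Some (tl a)
  | CNode f g =>
      if run f n a is Some b then if run g n a is Some c then Some (Node b c) else None
      else None
  | CComp f g => if run g n a is Some b then run f n b else None
  | CIf t f g =>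
      if run t n a is Some v then if is_Node v then run f n a else run g n a else None
  | CWhile t f =>
      let s := iter n (while_round (run t n) (run f n)) (false, Some a) in
      if s.1 then s.2 else None
  end.

Lemma while_round_Some test body a :
  while_round test body (false, Some a) =
  if test a is Some v then if is_Node v then (false, body a) else (true, Some a)
  else (false, None).
Proof. by []. Qed.

Lemma iter_while_round_stopped test body n (s : bool * option tree) :
  s.1 -> iter n (while_round test body) s = s.
Proof. by move=> Hs; elim: n => //= n ->; rewrite /while_round Hs. Qed.

Lemma iter_while_round_stuck test body n :
  iter n (while_round test body) (false, None) = (false, None).
Proof. by elim: n => //= n ->. Qed.

Lemma run_sound f n a b : run f n a = Some b -> halts_with f a b.
Proof.
elim: f a b => //=.
- by move=> a b [<-]; constructor.
- by move=> a b [<-]; constructor.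
- by move=> a b [<-]; constructor.
- by move=> a b [<-]; constructor.
- move=> f IHf g IHg a b; case Ef: (run f n a) => [c|] //; case Eg: (run g n a) => [d|] // [<-].
  by constructor; [apply: IHf | apply: IHg].
- move=> f IHf g IHg a b; case Eg: (run g n a) => [c|] // Ef.
  by apply: EvComp (IHg _ _ Eg) (IHf _ _ Ef).
- move=> t IHt f IHf g IHg a b; case Et: (run t n a) => [[|l r]|] //= E.
    by apply: EvIfFalse; [apply: IHt | apply: IHg].
  by apply: EvIfTrue; [exact: IHt Et | exact: IHf].
- move=> t IHt f IHf a b.
  (* The selected occurrences count rounds; the fuel of the test and of the body stays at [n] during
     the induction. *)
  elim: {1 4}n a => [|m IHm] a //; rewrite iterSr while_round_Some.
  case Et: (run t n a) => [[|l r]|] /=; last by rewrite iter_while_round_stuck.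
    by rewrite iter_while_round_stopped //= => -[<-]; apply: EvWhileStop; apply: IHt.
  case Ef: (run f n a) => [c|]; last by rewrite iter_while_round_stuck.
  by move=> /IHm; apply: EvWhileStep; [apply: IHt Et | apply: IHf].
Qed.

(** More fuel allows more rounds and makes the test and the body more defined. Neither affects a
    loop whose flag is already set. *)
Lemma iter_while_round_mono (t t' f f' : tree -> option tree) k l a :
  (forall a b, t a = Some b -> t' a = Some b) ->
  (forall a b, f a = Some b -> f' a = Some b) -> k <= l ->
  (iter k (while_round t f) (false, Some a)).1 ->
  iter l (while_round t' f') (false, Some a) = iter k (while_round t f) (false, Some a).
Proof.
move=> tt' ff'; elim: k l a => [|k IHk] [|l] a //; rewrite ltnS => kl.
rewrite !iterSr !while_round_Some.
case Et: (t a) => [v|]; last by rewrite iter_while_round_stuck.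
rewrite (tt' _ _ Et); case: ifP => _; last by rewrite !iter_while_round_stopped.
case Ef: (f a) => [c|]; last by rewrite iter_while_round_stuck.
by rewrite (ff' _ _ Ef); apply: IHk.
Qed.

Lemma run_mono f n m a b : n <= m -> run f n a = Some b -> run f m a = Some b.
Proof.
move=> nm; elim: f a b => //=.
- move=> f IHf g IHg a b; case Ef: (run f n a) => [c|] //; case Eg: (run g n a) => [d|] //.
  by rewrite (IHf _ _ Ef) (IHg _ _ Eg).
- by move=> f IHf g IHg a b; case Eg: (run g n a) => [c|] //; rewrite (IHg _ _ Eg); apply: IHf.
- move=> t IHt f IHf g IHg a b; case Et: (run t n a) => [v|] //.
  by rewrite (IHt _ _ Et); case: ifP => _; [apply: IHf | apply: IHg].
- move=> t IHt f IHf a b.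
  by case: ifP => // Hs E; rewrite (iter_while_round_mono IHt IHf nm Hs) Hs.
Qed.

Lemma run_complete f a b : halts_with f a b -> exists n, run f n a = Some b.
Proof.
elim=> {f a b}.
- by exists 0.
- by exists 0.
- by exists 0.
- by exists 0.
- move=> f g a b c _ [n Hn] _ [m Hm]; exists (maxn n m) => /=.
  by rewrite (run_mono (leq_maxl n m) Hn) (run_mono (leq_maxr n m) Hm).
- move=> f g a b c _ [n Hn] _ [m Hm]; exists (maxn n m) => /=.
  by rewrite (run_mono (leq_maxl n m) Hn) (run_mono (leq_maxr n m) Hm).
- move=> t f g a l r b _ [n Hn] _ [m Hm]; exists (maxn n m) => /=.
  by rewrite (run_mono (leq_maxl n m) Hn) /= (run_mono (leq_maxr n m) Hm).
- move=> t f g a b _ [n Hn] _ [m Hm]; exists (maxn n m) => /=.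
  by rewrite (run_mono (leq_maxl n m) Hn) /= (run_mono (leq_maxr n m) Hm).
(* The extra round is the one that sees the test fail and sets the flag. *)
- move=> t f a _ [n Hn]; exists n.+1 => /=.
  rewrite -iterS iterSr while_round_Some (run_mono (leqnSn n) Hn) /=.
  by rewrite iter_while_round_stopped.
- move=> t f a l r b c _ [n1 H1] _ [n2 H2] _ [n3 H3].
  pose m := maxn n1 (maxn n2 n3).
  have m1 : n1 <= m by rewrite leq_maxl.
  have m2 : n2 <= m by rewrite /m maxnCA leq_maxl.
  have m3 : n3 <= m by rewrite /m maxnA leq_maxr.
  exists m.+1; rewrite /= -iterS iterSr while_round_Some (run_mono (leqW m1) H1) /=.
  rewrite (run_mono (leqW m2) H2).
  move: H3 => /=; case: ifP => // Hs E.
  rewrite (iter_while_round_mono (k := n3) (t := run t n3) (f := run f n3)) ?Hs //.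
  + by move=> u v; apply: run_mono; apply: leqW.
  + by move=> u v; apply: run_mono; apply: leqW.
Qed.

(** The induction is on the fixed program [U]: each program gets a clocked evaluator of its own,
    assembled from those of its parts, with loops handled by [computable_iter]. *)
Lemma computable_run {E : Type} {eE : encoding E} U (n : E -> nat) (a : E -> tree) :
  computable n -> computable a -> computable (fun e => run U (n e) (a e)).
Proof.
enough (H : computable (fun p : nat * tree => run U p.1 p.2)).
  by move=> Hn Ha; exact (computable_comp (f := fun e => (n e, a e)) H (computable_pair Hn Ha)).
elim: U => [||||f Hf g Hg|f Hf g Hg|t Ht f Hf g Hg|t Ht f Hf] /=; try by computability.
- apply: (computable_match_option (f := fun p : nat * tree => run f p.1 p.2)
    (g := fun p b => if run g p.1 p.2 is Some c then Some (Node b c) else None)) => //.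
    apply: (computable_match_option (f := fun q : nat * tree * tree => run g q.1.1 q.1.2)
      (g := fun q c => Some (Node q.2 c))); try by computability.
    by apply: (computable_comp Hg); computability.
  exact: computable_const.
- apply: (computable_match_option (f := fun p : nat * tree => run g p.1 p.2)
    (g := fun p b => run f p.1 b)) => //; last exact: computable_const.
  by apply: (computable_comp (f := fun p : nat * tree * tree => (p.1.1, p.2)) Hf); computability.
- apply: (computable_match_option (f := fun p : nat * tree => run t p.1 p.2)
    (g := fun p v => if is_Node v then run f p.1 p.2 else run g p.1 p.2)) => //;
    last exact: computable_const.
  apply: computable_if; first by computability.
    by apply: (computable_comp Hf); computability.
  by apply: (computable_comp Hg); computability.
- pose s (p : nat * tree) := iter p.1 (while_round (run t p.1) (run f p.1)) (false, Some p.2).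
  assert (Hs : computable s).
    apply: (computable_iter
      (f := fun p : nat * tree => while_round (run t p.1) (run f p.1))); try by computability.
    apply: computable_if; try by computability.
    apply: (computable_match_option (f := fun q : nat * tree * (bool * option tree) => q.2.2)
      (g := fun q a => if run t q.1.1 a is Some v then if is_Node v then (false, run f q.1.1 a)
        else (true, Some a) else (false, None))); try by computability.
    pose T := (nat * tree * (bool * option tree) * tree)%type.
    apply: (computable_match_option (f := fun q : T => run t q.1.1.1 q.2)
      (g := fun q v => if is_Node v then (false, run f q.1.1.1 q.2) else (true, Some q.2)));
      try by computability.
      by apply: (computable_comp (f := fun p : T => (p.1.1.1, p.2)) Ht); computability.
    apply: computable_if; try by computability.
    apply: computable_pair; first exact: computable_const.
    by apply: (computable_comp (f := fun p : T * tree => (p.1.1.1.1, p.1.2)) Hf); computability.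
  by apply: (@computable_if _ _ _ _ (fun p => (s p).1) (fun p => (s p).2)); computability.
Qed.

End ClockedEvaluation.

(** * Two-part codes *)

Definition strings (k : nat) : seq (seq bool) :=
  iter k (fun S => [::] :: map (cons true) S ++ map (cons false) S) [:: [::]].

Lemma mem_strings p k : (p \in strings k) = (size p <= k).
Proof.
elim: k p => [|k IH] [|b p] //=.
rewrite inE /= mem_cat ltnS -IH.
have H c : (b :: p \in map (cons c) (strings k)) = (b == c) && (p \in strings k).
  apply/mapP/andP => [[q Hq [-> ->]]|[/eqP -> Hp]]; first by rewrite eqxx.
  by exists p.
by rewrite !H; case: b {H} => //=; rewrite orbF.
Qed.

Lemma size_strings k : (size (strings k)).+1 = 2 ^ k.+1.
Proof.
elim: k => //= k IH; rewrite size_cat !size_map expnS -IH; lia.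
Qed.

Lemma computable_strings {E : Type} {eE : encoding E} (k : E -> nat) :
  computable k -> computable (fun e => strings (k e)).
Proof.
move=> Hk; apply: (computable_iter
  (f := fun _ S => [::] :: map (cons true) S ++ map (cons false) S)) => //; last by computability.
cbv beta; apply: computable_cons; first by computability.
by apply: computable_cat;
   [apply: (computable_map (f := fun _ => cons true))
   |apply: (computable_map (f := fun _ => cons false))]; computability.
Qed.

(** The binary logarithm rounded up, with value 0 at 0: the number of bits that an index into a list
    of length [n] takes. *)
Definition clog (n : nat) : nat := find (fun m => n <= 2 ^ m) (iota 0 n).

Lemma leq_clog n : n <= 2 ^ clog n.
Proof.
rewrite /clog; case: (boolP (has (fun m => n <= 2 ^ m) (iota 0 n))) => [Hn|/hasNfind ->].
  have := nth_find 0 Hn; rewrite nth_iota ?add0n //.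
  by rewrite -[X in _ < X](size_iota 0 n) -has_find.
by rewrite size_iota ltnW // ltn_expl.
Qed.

Lemma clog_gt n m : m < clog n -> 2 ^ m < n.
Proof.
move=> Hm; have := before_find 0 Hm.
have Hmn : m < n by rewrite -(size_iota 0 n); apply: leq_trans Hm (find_size _ _).
by rewrite nth_iota // add0n => /negbT; rewrite -ltnNge.
Qed.

Lemma computable_clog {E : Type} {eE : encoding E} (n : E -> nat) :
  computable n -> computable (fun e => clog (n e)).
Proof.
move=> Hn; apply: (computable_find (f := fun e m => n e <= 2 ^ m)); last by computability.
by cbv beta; apply: computable_leq; [apply: (computable_comp Hn)|]; computability.
Qed.

Definition binval (q : seq bool) : nat :=
  foldl (fun v b => if b then (v + v).+1 else v + v) 0 q.

(** Leading zeros are allowed, so every number below 2^m has a numeral of exactly m bits. Code words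
    rely on such fields of prescribed length. *)
Lemma binval_surj m n : n < 2 ^ m -> exists q, size q = m /\ binval q = n.
Proof.
elim: m n => [|m IH] n; first by rewrite expn0 ltnS leqn0 => /eqP ->; exists [::].
rewrite expnS => Hn; have [|q [Hq Hv]] := IH n./2; first by lia.
exists (rcons q (odd n)); rewrite size_rcons Hq; split=> //.
rewrite /binval foldl_rcons -/(binval q) Hv.
by case: ifP => H; rewrite -[RHS](odd_double_half n) H -addnn.
Qed.

Lemma computable_binval {E : Type} {eE : encoding E} (q : E -> seq bool) :
  computable q -> computable (fun e => binval (q e)).
Proof.
move=> Hq; apply: (computable_foldl (g := fun _ v b => if b then (v + v).+1 else v + v)) => //;
by computability.
Qed.

(** * Listing programs in the order in which they halt *)

Section Enumeration.
Context (U : program).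

Definition printed (n : nat) (p : seq bool) : option (seq (seq bool)) :=
  if run U n (tree_of_string p) is Some t then decode_strings t else None.

Definition halted (n : nat) (p : seq bool) : bool := isSome (run U n (tree_of_string p)).

Lemma printed_prints n p s : printed n p = Some s -> prints U p s.
Proof.
rewrite /printed; case E: (run U n _) => [t|] // /decode_stringsP Et.
by rewrite /prints -Et; apply: run_sound E.
Qed.

Lemma prints_printed p s : prints U p s -> exists n, printed n p = Some s.
Proof.
move=> /run_complete [n Hn]; exists n; rewrite /printed Hn.
by apply/decode_stringsP.
Qed.

Lemma printed_mono n m p s : n <= m -> printed n p = Some s -> printed m p = Some s.
Proof. by rewrite /printed => nm; case E: (run U n _) => [t|] //; rewrite (run_mono nm E). Qed.

Lemma halted_mono n m p : n <= m -> halted n p -> halted m p.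
Proof. by rewrite /halted => nm; case E: (run U n _) => [t|] //; rewrite (run_mono nm E). Qed.

Lemma printed_halted n p s : printed n p = Some s -> halted n p.
Proof. by rewrite /printed /halted; case: (run U n _). Qed.

Lemma prints_det p s s' : prints U p s -> prints U p s' -> s = s'.
Proof.
move=> /prints_printed [n Hn] /prints_printed [m Hm].
have := printed_mono (leq_maxl n m) Hn.
by rewrite (printed_mono (leq_maxr n m) Hm) => -[].
Qed.

(** By determinism a program that prints [s] cannot halt with anything else, so the time at which it
    halts is also the time at which its output is known. *)
Lemma prints_halted_printed n p s : prints U p s -> halted n p -> printed n p = Some s.
Proof.
move=> /prints_printed [m Hm]; rewrite /halted /printed.
case E: (run U n _) => [t|] // _; move: Hm; rewrite /printed.
case E': (run U m _) => [t'|] //.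
by rewrite (halts_with_det (run_sound E) (run_sound E')).
Qed.

Lemma computable_printed {E : Type} {eE : encoding E} (n : E -> nat) (p : E -> seq bool) :
  computable n -> computable p -> computable (fun e => printed (n e) (p e)).
Proof.
move=> Hn Hp; apply: (computable_match_option (f := fun e => run U (n e) (tree_of_string (p e)))
  (g := fun _ t => decode_strings t)); last by computability.
  by apply: computable_run => //; apply: (computable_encode Hp).
by apply: computable_decode_strings; computability.
Qed.

Lemma computable_halted {E : Type} {eE : encoding E} (n : E -> nat) (p : E -> seq bool) :
  computable n -> computable p -> computable (fun e => halted (n e) (p e)).
Proof.
move=> Hn Hp; apply: computable_isSome.
by apply: computable_run => //; apply: (computable_encode Hp).
Qed.

(** Later stages only append, so the position of a program never changes and a complete block stays
    as it is. Stage [T] contains the programs that halt with fuel less than [T]; hence the shift in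
    [mem_discovered]. *)
Fixpoint discovered (k T : nat) : seq (seq bool) :=
  if T is t.+1 then
    discovered k t ++
      [seq p <- undup (strings k) | halted t p && ~~ (p \in discovered k t)]
  else [::].

Lemma discovered_cat k T T' : T <= T' -> exists M, discovered k T' = discovered k T ++ M.
Proof.
move=> /subnK <-; elim: (T' - T) => [|d [M IH]]; first by exists [::]; rewrite cats0.
by rewrite addSn /= IH -catA; eexists.
Qed.

Lemma mem_discovered k T p : size p <= k -> halted T p -> p \in discovered k T.+1.
Proof.
move=> pk Hp /=; rewrite mem_cat mem_filter mem_undup mem_strings pk Hp /= andbT.
by rewrite orbN.
Qed.

Lemma discovered_halted k T p : p \in discovered k T -> halted T p.
Proof.
elim: T => //= T IH; rewrite mem_cat mem_filter => /orP[/IH|/andP[/andP[]]] H.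
  exact: halted_mono H.
by move=> _ _; apply: halted_mono H.
Qed.

Lemma size_discovered k T : size (discovered k T) < 2 ^ k.+1.
Proof.
rewrite -size_strings ltnS; apply: uniq_leq_size.
  elim: T => //= T IH; rewrite cat_uniq IH filter_uniq ?undup_uniq // andbT.
  by apply/hasPn => p; rewrite mem_filter => /andP[/andP[]].
move=> p; elim: T => //= T IH; rewrite mem_cat mem_filter mem_undup.
by move=> /orP[/IH|/andP[]].
Qed.

Lemma computable_discovered {E : Type} {eE : encoding E} (k T : E -> nat) :
  computable k -> computable T -> computable (fun e => discovered (k e) (T e)).
Proof.
move=> Hk HT.
(* The stage number is carried along to turn the recursion into an iteration. *)
pose step k' (s : nat * seq (seq bool)) := (s.1.+1, s.2 ++
  [seq p <- undup (strings k') | halted s.1 p && ~~ (p \in s.2)]).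
apply: (@eq_computable _ _ _ _ _ (fun e => (iter (T e) (step (k e)) (0, [::])).2)) => [e|].
  suff -> : iter (T e) (step (k e)) (0, [::]) = (T e, discovered (k e) (T e)) by [].
  by elim: (T e) => //= t ->.
apply: computable_snd; apply: (computable_iter (f := fun e => step (k e))) => //.
  2: by computability.
rewrite /step; apply: computable_pair; first by computability.
apply: computable_cat; first by computability.
apply: (computable_filter (f := fun (p : E * (nat * seq (seq bool))) q =>
  halted p.2.1 q && ~~ (q \in p.2.2))).
  by apply: computable_andb; [apply: computable_halted|]; computability.
apply: computable_undup_bitseq; apply: computable_strings.
by apply: (computable_comp Hk); computability.
Qed.

Section TwoPartCode.

(** A code word is a program for a list followed by a position in it, written with exactly [clog]
    many bits. The boundary [l] is not marked, so [two_part] tries all of them. Repetitions are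
    removed because the cost is to be log|S|. *)
Definition two_part_at (T : nat) (z : seq bool) (l : nat) : option tree :=
  if printed T (take l z) is Some s then
    if size z - l == clog (size (undup s)) then
      Some (encode [:: nth [::] (undup s) (binval (drop l z))])
    else None
  else None.

Definition two_part (T : nat) (z : seq bool) : option tree :=
  foldr (fun t o => Some t) None (pmap (two_part_at T z) (iota 0 (size z).+1)).

Lemma computable_two_part : computable (fun p : nat * seq bool => two_part p.1 p.2).
Proof.
apply: (computable_foldr (g := fun _ t o => Some t)); try by computability.
apply: (computable_pmap (f := fun p => two_part_at p.1 p.2)); last by computability.
apply: (computable_match_option
  (f := fun q : nat * seq bool * nat => printed q.1.1 (take q.2 q.1.2))
  (g := fun q s => if size q.1.2 - q.2 == clog (size (undup s)) then
      Some (encode [:: nth [::] (undup s) (binval (drop q.2 q.1.2))]) else None)).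
- by apply: computable_printed; computability.
- apply: computable_if; last by computability.
    by apply: computable_eqn; [|apply: computable_clog]; computability.
  apply: computable_Some; apply: computable_encode; apply: computable_cons; last by computability.
  by apply: computable_nth; [| |apply: computable_binval]; computability.
- by computability.
Qed.

Lemma first_pmap (A : eqType) (B : Type) (f : A -> option B) s t :
  foldr (fun t o => Some t) None (pmap f s) = Some t -> exists2 a, a \in s & f a = Some t.
Proof.
elim: s => //= a s IH; case E: (f a) => [b|] /=.
  by move=> [<-]; exists a => //; rewrite mem_head.
by move=> /IH [a' Ha' Hf]; exists a' => //; rewrite inE Ha' orbT.
Qed.

Lemma first_pmap_Some (A : eqType) (B : Type) (f : A -> option B) s a b :
  a \in s -> f a = Some b -> exists t, foldr (fun t o => Some t) None (pmap f s) = Some t.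
Proof.
elim: s => //= a' s IH; rewrite inE => /orP[/eqP <- -> /=|Ha Hb]; first by exists b.
by case: (f a') => [b'|] /=; [exists b' | apply: IH].
Qed.

Lemma two_partP T z t : two_part T z = Some t ->
  exists l s, [/\ l <= size z, prints U (take l z) s, size z - l = clog (size (undup s)) &
    t = encode [:: nth [::] (undup s) (binval (drop l z))] ].
Proof.
move=> Ht; have [l] := first_pmap Ht; rewrite mem_iota add0n ltnS /= => Hl.
rewrite /two_part_at; case E: (printed _ _) => [s|] //; case: eqP => // Hs [<-].
by exists l, s; split=> //; apply: printed_prints E.
Qed.

Context (prefixU : prefix_machine U).

(** Both program parts are prefixes of [z2] on which the prefix machine [U] halts, so they coincide.
    The list and the length of the index are then the same, which leaves no room for an extension.
    With [z1 = z2] this says that decoding is unambiguous. *)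
Lemma two_part_inj l1 l2 z1 z2 s1 s2 :
  prefix z1 z2 -> l1 <= size z1 -> l2 <= size z2 ->
  prints U (take l1 z1) s1 -> prints U (take l2 z2) s2 ->
  size z1 - l1 = clog (size (undup s1)) -> size z2 - l2 = clog (size (undup s2)) ->
  [/\ l1 = l2, s1 = s2 & z1 = z2].
Proof.
move=> /prefixP [w Ez] Hl1 Hl2 Hp1 Hp2 Hs1 Hs2.
have Et : take l1 z1 = take l1 z2.
  by rewrite Ez take_cat; case: ltngtP Hl1 => // -> _; rewrite subnn take0 cats0 take_size.
have Ep : take l1 z2 = take l2 z2.
  rewrite Et in Hp1; case/orP: (leq_total l1 l2) => H.
    by apply: (prefixU Hp1 Hp2); rewrite -(take_takel z2 H) prefix_take.
  by apply/esym; apply: (prefixU Hp2 Hp1); rewrite -(take_takel z2 H) prefix_take.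
have El : l1 = l2.
  have := congr1 size Ep; rewrite !size_takel //.
  by rewrite Ez size_cat; apply: leq_trans Hl1 (leq_addr _ _).
have Es : s1 = s2 by apply: (prints_det Hp1); rewrite Et Ep.
split=> //; rewrite -Es -Hs1 -El in Hs2.
move: Hs2; rewrite Ez size_cat => Hs2.
have /size0nil -> : size w = 0 by lia.
by rewrite cats0.
Qed.

(* Knowing that x is in a printed list, x is given by its position in the list:
   this is the inequality K(x) <= K(S) + log |S| + O(1). *)
Lemma two_part_machine : exists V, prefix_machine V /\
  forall p s x, prints U p s -> x \in s ->
    exists z, size z = size p + clog (size (undup s)) /\ prints V z [:: x].
Proof.
have [V HV] := unbounded_search computable_two_part.
exists V; split.
  move=> z1 z2 a b /HV [T1 /two_partP [l1 [s1 [Hl1 Hp1 Hs1 _]]] _].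
  move=> /HV [T2 /two_partP [l2 [s2 [Hl2 Hp2 Hs2 _]]] _] Hz.
  by case: (two_part_inj Hz Hl1 Hl2 Hp1 Hp2 Hs1 Hs2).
move=> p s x Hp Hx.
have Hi : index x (undup s) < 2 ^ clog (size (undup s)).
  by apply: leq_trans (leq_clog _); rewrite index_mem mem_undup.
have [q [Hq Hv]] := binval_surj Hi.
exists (p ++ q); rewrite size_cat Hq; split=> //; apply/HV.
have [T HT] := prints_printed Hp.
have HS : exists T, two_part T (p ++ q).
  exists T; have [||t] := @first_pmap_Some _ _ (two_part_at T (p ++ q)) (iota 0 (size (p ++ q)).+1)
    (size p) (encode [:: nth [::] (undup s) (binval (drop (size p) (p ++ q)))]).
  - by rewrite mem_iota add0n /= ltnS size_cat leq_addr.
  - by rewrite /two_part_at take_size_cat // HT size_cat addKn Hq eqxx.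
  - by rewrite /two_part => ->.
have [T0 HT0 Tmin] := ex_minnP HS.
case E: (two_part T0 (p ++ q)) HT0 => [t|] // _; exists T0.
  rewrite E; congr Some.
  (* The search could stop at a split other than the intended one; [two_part_inj] with equal words
     excludes this. *)
  have [l [s' [Hl Hp' Hs' ->]]] := two_partP E.
  have Hp1 : prints U (take (size p) (p ++ q)) s by rewrite take_size_cat.
  case: (@two_part_inj l (size p) (p ++ q) (p ++ q) s' s) => //; rewrite ?prefix_refl //.
  - by rewrite size_cat leq_addr.
  - by rewrite size_cat addKn.
  by move=> -> -> _; rewrite drop_size_cat // Hv nth_index ?mem_undup.
move=> T' HT'; case E': (two_part T' _) => [t'|] //.
by have := Tmin T'; rewrite E' => /(_ erefl); rewrite leqNgt HT'.
Qed.

End TwoPartCode.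
End Enumeration.

(** * Block codes *)

Section BlockCode.
Context (U : program).

(* A code word is 1^l 0 u v f r with |u| = |v| = l and |r| = binval v. *)
Definition header (z : seq bool) : nat := find negb z.
Definition word_bound (z : seq bool) : nat :=
  binval (take (header z) (drop (header z).+1 z)).
Definition word_length (z : seq bool) : nat :=
  binval (take (header z) (drop (header z + header z).+1 z)).
Definition word_flag (z : seq bool) : bool :=
  nth false z (header z + header z + header z).+1.
Definition word_tail (z : seq bool) : seq bool :=
  drop (header z + header z + header z).+2 z.
Definition wellformed (z : seq bool) : bool :=
  size z == (header z + header z + header z).+2 + word_length z.

(** The list has fewer than 2^(k+1) elements for k = [word_bound z], so with this size the block
    numbers fit in [word_length z] bits. *)
Definition block_size (z : seq bool) : nat := 2 ^ ((word_bound z).+1 - word_length z).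

(** Keeping one string per program makes the output no longer than the block. A program that prints
    no string contributes the empty string, which does no harm. *)
Definition first_printed (T : nat) (p : seq bool) : seq bool :=
  if printed U T p is Some s then head [::] s else [::].

(* If the flag is set, r is the number of a complete block of the list of
   discovered programs; otherwise r is a program whose halting time selects the
   last elements of the list. *)
Definition block_stop (T : nat) (z : seq bool) : bool :=
  wellformed z &&
  (if word_flag z then
     (binval (word_tail z)).+1 * block_size z <= size (discovered U (word_bound z) T)
   else halted U T (word_tail z)).

(** For an unset flag the last [block_size z] elements are taken, which include the incomplete
    block. Truncated subtraction gives the whole list when it is shorter than that. *)
Definition block_start (T : nat) (z : seq bool) : nat :=
  if word_flag z then binval (word_tail z) * block_size z
  else size (discovered U (word_bound z) T) - block_size z.

Definition block_search (T : nat) (z : seq bool) : option tree :=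
  if block_stop T z then
    Some (encode (map (first_printed T)
      (take (block_size z) (drop (block_start T z) (discovered U (word_bound z) T)))))
  else None.

Section Computability.
Context {E : Type} {eE : encoding E}.

Lemma computable_header (z : E -> seq bool) :
  computable z -> computable (fun e => header (z e)).
Proof.
by move=> Hz; apply: (computable_find (f := fun _ => negb)) => //; computability.
Qed.

Lemma computable_word_bound (z : E -> seq bool) :
  computable z -> computable (fun e => word_bound (z e)).
Proof.
move=> Hz; have Hh := computable_header Hz.
by apply: computable_binval; computability.
Qed.

Lemma computable_word_length (z : E -> seq bool) :
  computable z -> computable (fun e => word_length (z e)).
Proof.
move=> Hz; have Hh := computable_header Hz.
by apply: computable_binval; computability.
Qed.

Lemma computable_word_flag (z : E -> seq bool) :
  computable z -> computable (fun e => word_flag (z e)).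
Proof.
by move=> Hz; have Hh := computable_header Hz; rewrite /word_flag; computability.
Qed.

Lemma computable_word_tail (z : E -> seq bool) :
  computable z -> computable (fun e => word_tail (z e)).
Proof.
by move=> Hz; have Hh := computable_header Hz; rewrite /word_tail; computability.
Qed.

Lemma computable_block_size (z : E -> seq bool) :
  computable z -> computable (fun e => block_size (z e)).
Proof.
move=> Hz; have Hb := computable_word_bound Hz; have Hl := computable_word_length Hz.
by rewrite /block_size; computability.
Qed.

End Computability.

Lemma computable_block_search : computable (fun p : nat * seq bool => block_search p.1 p.2).
Proof.
pose z (p : nat * seq bool) := p.2.
assert (Hz : computable z) by exact: computable_snd computable_id.
assert (HT : computable (fun p : nat * seq bool => p.1)) by exact: computable_fst computable_id.
have Hh := computable_header Hz; have Hb := computable_word_bound Hz.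
have Hl := computable_word_length Hz; have Hf := computable_word_flag Hz.
have Ht := computable_word_tail Hz; have HB := computable_block_size Hz.
have HL := computable_discovered U Hb HT; have Hv := computable_binval Ht.
have Hstop := computable_halted U HT Ht.
apply: computable_if; last by computability.
  by rewrite /block_stop /wellformed; computability.
apply: computable_Some; apply: computable_encode.
apply: (computable_map (f := fun p q => first_printed p.1 q)).
  apply: (computable_match_option (f := fun p : nat * seq bool * seq bool => printed U p.1.1 p.2)
    (g := fun _ s => head [::] s)); try by computability.
  by apply: computable_printed; computability.
by rewrite /block_start; computability.
Qed.

Lemma wellformedP z :
  wellformed z -> size z = (header z + header z + header z).+2 + word_length z.
Proof. by move/eqP. Qed.

(** The header and the length field lie inside [z1], so both words announce the same total
    length. *)
Lemma wellformed_prefix (z1 z2 : seq bool) :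
  prefix z1 z2 -> wellformed z1 -> wellformed z2 -> z1 = z2.
Proof.
move=> /prefixP [w ->] /wellformedP H1 /wellformedP.
have Hh : header (z1 ++ w) = header z1.
  by rewrite /header find_cat has_find -/(header z1) H1; case: ifP => // H; lia.
rewrite /word_length Hh.
have -> : take (header z1) (drop (header z1 + header z1).+1 (z1 ++ w)) =
          take (header z1) (drop (header z1 + header z1).+1 z1).
  have Hlt : (header z1 + header z1).+1 < size z1.
    by rewrite H1 !addSn !ltnS -addnA leq_addr.
  rewrite drop_cat Hlt take_cat size_drop; case: ifP => // H.
  have -> : header z1 - (size z1 - (header z1 + header z1).+1) = 0 by rewrite H1; lia.
  by rewrite take0 cats0 take_oversize // size_drop H1; lia.
rewrite -/(word_length z1) -H1 size_cat => H.
move/eqP: H; rewrite -[X in _ == X]addn0 eqn_add2l => /eqP /size0nil ->.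
by rewrite cats0.
Qed.

Lemma codeword (l : nat) (u v r : seq bool) (f : bool) :
  size u = l -> size v = l -> binval v = size r ->
  exists z, [/\ size z = 3 * l + 2 + size r, wellformed z, word_bound z = binval u,
    word_length z = size r & word_flag z = f /\ word_tail z = r].
Proof.
move=> Hu Hv Hr; pose z := nseq l true ++ false :: u ++ v ++ f :: r; exists z.
have Hh : header z = l.
  rewrite /header find_cat size_nseq /=.
  by have -> : has negb (nseq l true) = false; [rewrite has_nseq /= andbF | rewrite addn0].
have D n : drop (l + n).+1 z = drop n (u ++ v ++ f :: r).
  by rewrite /z -cat_rcons drop_cat size_rcons size_nseq; case: ifP => [H|_];
    [lia | rewrite -addSn addKn].
have Hb : word_bound z = binval u.
  by rewrite /word_bound Hh -[X in X.+1]addn0 D drop0 take_size_cat.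
have D2 n : drop (l + (l + n)).+1 z = drop n (v ++ f :: r).
  by rewrite D [l + n]addnC -drop_drop drop_size_cat.
have Hl : word_length z = size r.
  by rewrite /word_length Hh -[X in l + X]addn0 D2 drop0 take_size_cat.
have D3 n : drop (l + (l + (l + n))).+1 z = drop n (f :: r).
  by rewrite D2 [l + n]addnC -drop_drop drop_size_cat.
have Hz : size z = 3 * l + 2 + size r.
  by rewrite /z !size_cat /= !size_cat /= size_nseq Hu Hv; lia.
split=> //.
  by rewrite /wellformed Hz Hh Hl; apply/eqP; lia.
split.
  by rewrite /word_flag Hh -[_.+1]addn0 -nth_drop -addnA -[X in l + (l + X)]addn0 D3.
by rewrite /word_tail Hh -addnA -addnS -(addn1 (l + l)) -addnA D3 /= drop0.
Qed.

(** The code word has a tail of exactly |q| bits whether the tail is a block number or [q] itself,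
    so one block size fits both cases. The remaining 3l + 2 bits are the header, the fields for k
    and |q|, and the flag. *)
Lemma block_machine : exists V, prefix_machine V /\
  forall (k l t : nat) (x p0 q : seq bool), k < 2 ^ l ->
    size p0 <= k -> printed U t p0 = Some [:: x] ->
    size q <= k -> ~~ halted U t q -> (exists t', halted U t' q) ->
    exists z s, [/\ size z = 3 * l + 2 + size q, prints V z s, x \in s &
      size s <= 2 ^ (k.+1 - size q)].
Proof.
have [V HV] := unbounded_search computable_block_search.
exists V; split.
  move=> z1 z2 a b /HV [T1 H1 _] /HV [T2 H2 _] Hz; apply: wellformed_prefix => //.
    by move: H1; rewrite /block_search; case: ifP => // /andP[].
  by move: H2; rewrite /block_search; case: ifP => // /andP[].
move=> k l t x p0 q kl Hp0 Hx Hq Hqt Hq'.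
set B := 2 ^ (k.+1 - size q).
have B0 : 0 < B by rewrite expn_gt0.
have [T1 HT1 T1min] := ex_minnP Hq'.
have tT1 : t < T1.
  by rewrite ltnNge; apply: contra Hqt => H; apply: halted_mono HT1.
(* [p0] is sure to be listed from stage t + 1 on, which is why the strict inequality t < T1
   matters. *)
have p0L : p0 \in discovered U k T1.
  have [M ->] := discovered_cat U k tT1.
  by rewrite mem_cat mem_discovered // (printed_halted Hx).
set n := index p0 (discovered U k T1).
have nL : n < size (discovered U k T1) by rewrite index_mem.
set b := n %/ B.
have [u [Hu Hku]] := binval_surj kl.
have [v [Hv Hqv]] := binval_surj (leq_ltn_trans Hq kl).
have out z T : block_stop T z -> (forall T', T' < T -> ~~ block_stop T' z) ->
    prints V z (map (first_printed T)
      (take (block_size z) (drop (block_start T z) (discovered U (word_bound z) T)))).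
  move=> HT Tmin; apply/HV; exists T; first by rewrite /block_search HT.
  by move=> T' /Tmin; rewrite /block_search => /negbTE ->.
have xP T : p0 \in discovered U k T -> first_printed T p0 = x.
  move=> /discovered_halted HT.
  by rewrite /first_printed (prints_halted_printed (printed_prints Hx) HT).
have in_block T m : p0 \in discovered U k T -> T <= T1 ->
    m <= index p0 (discovered U k T) < m + B ->
    x \in map (first_printed T) (take B (drop m (discovered U k T))).
  move=> HT _ /andP[m1 m2]; rewrite -(xP _ HT); apply: map_f.
  have -> : p0 = nth p0 (take B (drop m (discovered U k T))) (index p0 (discovered U k T) - m).
    by rewrite nth_take ?ltn_subLR // nth_drop subnKC // nth_index.
  apply: mem_nth; rewrite size_take_min size_drop ltn_min ltn_subLR // m2 /=.
  by rewrite ltn_sub2r // ?index_mem // (leq_ltn_trans m1) ?index_mem.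
have idx T : p0 \in discovered U k T -> T <= T1 -> index p0 (discovered U k T) = n.
  by move=> HT TT; have [M HM] := discovered_cat U k TT; rewrite /n HM index_cat HT.
have [Hfull|Hpart] := leqP (b.+1 * B) (size (discovered U k T1)).
  have bq : b < 2 ^ size q.
    have Hlt : b * B < 2 ^ size q * B.
      rewrite -expnD subnKC ?(leqW Hq) //.
      by apply: leq_ltn_trans (leq_trunc_div n B) (ltn_trans nL (size_discovered U k T1)).
    by move: Hlt; rewrite ltn_pmul2r.
  have [r [Hr Hrb]] := binval_surj bq.
  have [|z [Hz Hwf Hzb Hzl [Hzf Hzt]]] := @codeword l u v r true Hu Hv; first by rewrite Hr.
  have HBz : block_size z = B by rewrite /block_size Hzb Hku Hzl Hr.
  have stopE T : block_stop T z = (b.+1 * B <= size (discovered U k T)).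
    by rewrite /block_stop Hwf Hzf Hzt Hrb HBz Hzb Hku.
  have HS : exists T, block_stop T z by exists T1; rewrite stopE.
  have [T2 HT2 T2min] := ex_minnP HS.
  have T21 : T2 <= T1 by apply: T2min; rewrite stopE.
  (* The machine may stop before [T1], but by then everything up to the end of block [b] is listed,
     and [p0] is in this block. *)
  have p0T2 : p0 \in discovered U k T2.
    rewrite stopE in HT2; have [M HM] := discovered_cat U k T21.
    have n2 : n < size (discovered U k T2).
      by apply: leq_trans HT2; rewrite /b ltn_ceil.
    by move: n2; rewrite /n HM index_cat; case: ifP => // _; rewrite ltnNge leq_addr.
  exists z; eexists; split; [by rewrite Hz Hr| | |].
  - apply: (out z T2 HT2) => T' HT'; apply/negP => /T2min; rewrite leqNgt HT' //.
  - rewrite HBz Hzb Hku; apply: in_block => //.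
    rewrite /block_start Hzf Hzt Hrb HBz idx // leq_trunc_div /=.
    by rewrite addnC -mulSn ltn_ceil.
  - by rewrite size_map size_take_min HBz geq_minl.
have [|z [Hz Hwf Hzb Hzl [Hzf Hzt]]] := @codeword l u v q false Hu Hv; first by rewrite Hqv.
have HBz : block_size z = B by rewrite /block_size Hzb Hku Hzl.
have stopE T : block_stop T z = halted U T q by rewrite /block_stop Hwf Hzf Hzt.
exists z; eexists; split; [by rewrite Hz| | |].
- apply: (out z T1); rewrite ?stopE // => T' HT'; rewrite stopE; apply/negP => /T1min.
  by rewrite leqNgt HT'.
- rewrite HBz Hzb Hku; apply: in_block => //.
  rewrite /block_start Hzf HBz Hzb Hku -/n.
  (* The list ends before block [b] would, so its last [B] elements start no later than that
     block. *)
  have := leq_trunc_div n B; rewrite -/b; move: Hpart nL; rewrite mulSn => *; lia.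
- by rewrite size_map size_take_min HBz geq_minl.
Qed.

End BlockCode.

(** * The algorithm *)

Section ProfileAlgorithm.
Context (U : program).

Definition ominn (n : nat) (o : option nat) : option nat :=
  if o is Some m then Some (minn n m) else Some n.

Definition list_cost (T : nat) (x p : seq bool) : option nat :=
  if printed U T p is Some s then
    if x \in s then Some (size p + clog (size (undup s))) else None
  else None.

(* The structure function of x as known after time T, rounded up. *)
Definition approx_profile (T : nat) (x : seq bool) (i : nat) : option nat :=
  foldr ominn None (pmap (list_cost T x) (strings i)).

Definition int_leq_nat (z : int) (i : nat) : bool := if z is Posz n then n <= i else true.

(** From alpha_0 on, [lambda] lies between K(x) - O(1) and lambda_x(alpha_0). The number k is in the
    same range and, unlike these two bounds, is known to the algorithm. *)
Definition profile (T : nat) (x : seq bool) (k : nat) (alpha0 : int) (i : nat) : option nat :=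
  if int_leq_nat alpha0 i then Some k else approx_profile T x i.

Definition prints_only (T : nat) (x p : seq bool) : bool :=
  if printed U T p is Some s then (size s == 1) && (x \in s) else false.

Definition profile_search (T : nat) (a : seq bool * (nat * int)) : option tree :=
  if has (prints_only T a.1) (strings a.2.1) then
    Some (encode (map (profile T a.1 a.2.1 a.2.2) (iota 0 a.2.1.+1)))
  else None.

Lemma prints_onlyP T x p : prints_only T x p <-> printed U T p = Some [:: x].
Proof.
rewrite /prints_only; case: (printed U T p) => [s|] //; split.
  by case: s => [|y [|z s]] //=; rewrite inE => /eqP ->.
by move=> [->]; rewrite /= inE eqxx.
Qed.

Lemma approx_profile_le T x i p s :
  size p <= i -> printed U T p = Some s -> x \in s ->
  exists2 n, approx_profile T x i = Some n & n <= size p + clog (size (undup s)).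
Proof.
rewrite -mem_strings /approx_profile => Hp Hs Hx.
have : list_cost T x p = Some (size p + clog (size (undup s))) by rewrite /list_cost Hs Hx.
elim: (strings i) Hp => //= q S IH; rewrite inE => /orP[/eqP <- ->|Hp Hc] /=.
  by case: (foldr _ _ _) => [m|] /=; eexists; rewrite // geq_minl.
have [n En Hn] := IH Hp Hc.
case: (list_cost T x q) => [m|] /=; rewrite En; last by exists n.
by eexists; [by []|]; apply: leq_trans (geq_minr _ _) Hn.
Qed.

Lemma approx_profile_attained T x i n : approx_profile T x i = Some n ->
  exists p s, [/\ size p <= i, printed U T p = Some s, x \in s &
    n = size p + clog (size (undup s))].
Proof.
rewrite /approx_profile => H.
have [p Hp] : exists2 p, p \in strings i & list_cost T x p = Some n.
  elim: (strings i) n H => //= q S IH n; case E: (list_cost T x q) => [m|] /=.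
    case E': (foldr _ _ _) => [m'|] /= [<-].
      rewrite /minn; case: ifP => _; first by exists q => //; rewrite mem_head.
      by have [r Hr Er] := IH _ E'; exists r => //; rewrite inE Hr orbT.
    by exists q => //; rewrite mem_head.
  by move=> /IH [r Hr Er]; exists r => //; rewrite inE Hr orbT.
rewrite mem_strings in Hp; rewrite /list_cost; case Es: (printed U T p) => [s|] //.
by case: ifP => // Hx [<-]; exists p, s.
Qed.

Lemma computable_int_leq_nat {E : Type} {eE : encoding E} (z : E -> int) (i : E -> nat) :
  computable z -> computable i -> computable (fun e => int_leq_nat (z e) (i e)).
Proof.
move=> [P HP] Hi.
pose sgn e := if z e is Posz n then false else true.
pose mag e := match z e with Posz n => n | Negz n => n end.
assert (Hs : computable sgn).
  exists (CComp CHd P) => e; apply: EvComp (HP e) _.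
  by rewrite /sgn; case: (z e) => n; apply: EvHd.
assert (Hm : computable mag).
  exists (CComp CTl P) => e; apply: EvComp (HP e) _.
  by rewrite /mag; case: (z e) => n; apply: EvTl.
apply: (@eq_computable _ _ _ _ _ (fun e => sgn e || (mag e <= i e))) => [e|].
  by rewrite /int_leq_nat /sgn /mag; case: (z e).
by computability.
Qed.

Lemma computable_prints_only {E : Type} {eE : encoding E} (T : E -> nat) (x p : E -> seq bool) :
  computable T -> computable x -> computable p ->
  computable (fun e => prints_only (T e) (x e) (p e)).
Proof.
move=> HT Hx Hp.
apply: (computable_match_option (f := fun e => printed U (T e) (p e))
  (g := fun e s => (size s == 1) && (x e \in s))); last by computability.
  exact: computable_printed.
apply: computable_andb; first by computability.
apply: computable_mem_bitseq; last by computability.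
by apply: (computable_comp Hx); computability.
Qed.

Lemma computable_list_cost {E : Type} {eE : encoding E} (T : E -> nat) (x p : E -> seq bool) :
  computable T -> computable x -> computable p ->
  computable (fun e => list_cost (T e) (x e) (p e)).
Proof.
move=> HT Hx Hp.
apply: (computable_match_option (f := fun e => printed U (T e) (p e))
  (g := fun e s => if x e \in s then Some (size (p e) + clog (size (undup s))) else None)).
- exact: computable_printed.
- apply: computable_if; last by computability.
    apply: computable_mem_bitseq; last by computability.
    by apply: (computable_comp Hx); computability.
  apply: computable_Some; apply: computable_addn; last by apply: computable_clog; computability.
  by apply: computable_size; apply: (computable_comp Hp); computability.
- by computability.
Qed.

Lemma computable_approx_profile {E : Type} {eE : encoding E} (T : E -> nat)
    (x : E -> seq bool) (i : E -> nat) :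
  computable T -> computable x -> computable i ->
  computable (fun e => approx_profile (T e) (x e) (i e)).
Proof.
move=> HT Hx Hi.
apply: (computable_foldr (g := fun _ => ominn)); last 2 first.
- by computability.
- apply: (computable_pmap (f := fun e => list_cost (T e) (x e))); last exact: computable_strings.
  by apply: computable_list_cost; [apply: (computable_comp HT)|apply: (computable_comp Hx)|];
    computability.
apply: (computable_match_option (f := fun p : E * (nat * option nat) => p.2.2)
  (g := fun p m => Some (minn p.2.1 m))); by computability.
Qed.

Lemma computable_profile_search :
  computable (fun p : nat * (seq bool * (nat * int)) => profile_search p.1 p.2).
Proof.
apply: computable_if; last by computability.
  apply: (computable_has (f := fun p q => prints_only p.1 p.2.1 q)).
    by apply: computable_prints_only; computability.
  by apply: computable_strings; computability.
apply: computable_Some; apply: computable_encode.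
apply: (computable_map (f := fun p i => profile p.1 p.2.1 p.2.2.1 p.2.2.2 i));
  last by computability.
apply: computable_if.
- by apply: computable_int_leq_nat; computability.
- by computability.
- by apply: computable_approx_profile; computability.
Qed.

(** The search stops because of [p], but the program [q] it finds may be a different and longer one.
    What the analysis takes from it is that its length is at most k and that it has printed x by
    time [T]. *)
Lemma profile_algorithm : exists A, forall x k (alpha0 : int) p,
  size p <= k -> prints U p [:: x] ->
  exists T q, [/\ size q <= k, printed U T q = Some [:: x] &
    halts_with A (Node (tree_of_string x) (Node (tree_of_nat k) (tree_of_int alpha0)))
      (tree_of_seq (tree_of_option tree_of_nat) (mkseq (profile T x k alpha0) k.+1))].
Proof.
have [A HA] := unbounded_search computable_profile_search.
exists A => x k alpha0 p Hp /prints_printed [T0 HT0].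
have HS : exists T, has (prints_only T x) (strings k).
  by exists T0; apply/hasP; exists p; rewrite ?mem_strings //; apply/prints_onlyP.
have [T HT Tmin] := ex_minnP HS.
have /hasP [q] := HT; rewrite mem_strings => Hq /prints_onlyP Hx.
exists T, q; split=> //; apply/(HA (x, (k, alpha0))).
exists T; first by rewrite /profile_search HT.
move=> T' HT'; rewrite /profile_search; case: ifP => // /Tmin.
by rewrite leqNgt HT'.
Qed.

End ProfileAlgorithm.

(** * Divergence of the empty program *)

Definition never_halts : program := CWhile (CNode CLeaf CLeaf) CId.

Lemma never_haltsP a b : ~ halts_with never_halts a b.
Proof.
suff H f c d : halts_with f c d -> f <> never_halts by move=> /H; apply.
elim=> // {f c d}.
by move=> t f a' Ht _ [Et _]; rewrite Et in Ht; inversion Ht.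
Qed.

(* Two machines that halt on the empty input only, with different results, have
   different adjunction prefixes. *)
Lemma universal_empty_diverges U : universal_prefix_machine U ->
  forall a, ~ halts_with U (tree_of_string [::]) a.
Proof.
move=> [Upre Uuniv] a Ha.
pose V f := CIf CId never_halts f.
have VE f p b : halts_with (V f) (tree_of_string p) b -> p = [::].
  case: p => // c p H.
  inversion H as [| | | | | |? ? ? ? ? ? ? ? Hn|? ? ? ? ? Hc| |]; subst.
    by case: (never_haltsP Hn).
  by inversion Hc.
have VP f : prefix_machine (V f).
  by move=> p q b c /VE -> /VE ->.
(* If [U] halts on the empty string, prefix-freeness forces the adjunction prefix [w] to be empty,
   so [U] itself must give the result of every [V f] there. *)
have empty_word f b : halts_with f Leaf b -> halts_with U (tree_of_string [::]) b.
  move=> Hf; have [w Hw] := Uuniv _ (VP f).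
  have Hb : halts_with U (tree_of_string w) b.
    by rewrite -[w]cats0; apply/Hw; apply: EvIfFalse => //; constructor.
  by rewrite (Upre _ _ _ _ Ha Hb (prefix0s w)).
have H1 := empty_word _ _ (EvLeaf Leaf).
have H2 := empty_word _ _ (EvNode (EvLeaf Leaf) (EvLeaf Leaf)).
by have := halts_with_det H1 H2.
Qed.

(** * The structure function *)

Local Open Scope classical_set_scope.
Local Open Scope ring_scope.
Local Open Scope ereal_scope.

Section StructureFunction.
Context (R : realType) (U : program).

(** Well-ordering of the lengths turns the infima in [KC] and [KC_set] into minima. *)
Lemma ereal_inf_natP (T : Type) (P : set T) (f : T -> nat) :
  ereal_inf [set ((f p)%:R%:E : \bar R) | p in P] = +oo \/
  exists2 p, P p & ereal_inf [set ((f p)%:R%:E : \bar R) | p in P] = (f p)%:R%:E.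
Proof.
have [[p0 Hp0]|Hno] := pselect (exists p, P p); last first.
  left; have -> : P = set0 by apply/seteqP; split=> // p Hp; case: Hno; exists p.
  by rewrite image_set0 ereal_inf0.
right; have Hex : exists n, `[< (exists2 p, P p & f p = n) >].
  by exists (f p0); apply/asboolP; exists p0.
have [n /asboolP [p Hp Hn] Hmin] := ex_minnP Hex.
exists p => //; apply/eqP; rewrite eq_le; apply/andP; split.
  by apply: ereal_inf_lbound; exists p.
apply: le_ereal_inf_tmp => _ [q Hq <-]; rewrite lee_fin ler_nat Hn.
by apply: Hmin; apply/asboolP; exists q.
Qed.

Lemma ln2_gt0 : (0 < ln 2 :> R)%R.
Proof. by rewrite ln_gt0 // ltr1n. Qed.

Lemma logb2_exp2 n : logb2 (2 ^ n)%:R = n%:R :> R.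
Proof.
rewrite /logb2 natrX lnXn ?ltr0n // -[(ln _ *+ _)%R]mulr_natl mulfK //.
by rewrite gt_eqF // ln2_gt0.
Qed.

Lemma ler_logb2 (m n : nat) : (0 < m)%N -> (m <= n)%N -> (logb2 m%:R <= logb2 n%:R :> R)%R.
Proof.
move=> m0 mn; rewrite /logb2 ler_pM2r ?invr_gt0 ?ln2_gt0 //.
by rewrite ler_ln ?posrE ?ltr0n ?ler_nat // (leq_trans m0).
Qed.

Lemma logb2_le_clog n : (0 < n)%N -> (logb2 n%:R <= (clog n)%:R :> R)%R.
Proof. by move=> n0; rewrite -(logb2_exp2 (clog n)) ler_logb2 // leq_clog. Qed.

Lemma clog_le_logb2 n : (0 < n)%N -> ((clog n)%:R <= logb2 n%:R + 1 :> R)%R.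
Proof.
move=> n0; case E: (clog n) => [|m].
  apply: addr_ge0 => //; have := @ler_logb2 1 n isT n0.
  by rewrite /logb2 ln1 mul0r.
rewrite -addn1 natrD lerD2r -(logb2_exp2 m) ler_logb2 ?expn_gt0 // ltnW // clog_gt //.
by rewrite E.
Qed.

Lemma mem_size_undup (x : seq bool) (s : seq (seq bool)) : x \in s -> (0 < size (undup s))%N.
Proof. by rewrite -mem_undup; case: (undup s). Qed.

Lemma lambda_le x (alpha : int) p s : prints U p s -> x \in s ->
  ((size p)%:R <= alpha%:~R :> R)%R ->
  lambda R U x alpha <= ((size p)%:R + logb2 (size (undup s))%:R)%:E.
Proof.
move=> Hp Hx Hal; pose S := [fset y in s]%fset.
have HS : KC_set R U S <= (size p)%:R%:E.
  by apply: ereal_inf_lbound; exists p => //; exists s; split=> // y; rewrite inE.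
apply: (@le_trans _ _ (Lambda R U S)).
  apply: ereal_inf_lbound; exists S => //; split; first by rewrite inE.
  by apply: le_trans HS _; rewrite lee_fin.
by rewrite /Lambda card_fseq EFinD leeD2r.
Qed.

(** Together with [lambda_le] this replaces the minimum over finite sets by one over printing
    programs: a shortest program for S realises K(S), and its list without repetitions has |S|
    elements. *)
Lemma lambda_ge x (alpha : int) (v : \bar R) :
  (forall p s, prints U p s -> x \in s -> ((size p)%:R <= alpha%:~R :> R)%R ->
     v <= ((size p)%:R + logb2 (size (undup s))%:R)%:E) ->
  v <= lambda R U x alpha.
Proof.
move=> H; apply: le_ereal_inf_tmp => _ [S [Hx HS] <-]; rewrite /Lambda.
have [E|[p [s [Hp Hs]] E]] := @ereal_inf_natP bitseq
    [set p | exists s : seq bitseq, prints U p s /\ s =i S] size.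
  by move: HS; rewrite /KC_set E leye_eq.
move: HS; rewrite /KC_set E lee_fin => HS.
have -> : #|` S|%fset = size (undup s).
  apply/perm_size/uniq_perm; rewrite ?undup_uniq ?fset_uniq //.
  by move=> y; rewrite mem_undup Hs.
by rewrite -EFinD; apply: H; rewrite ?Hs.
Qed.

Lemma lambda_antimono x (alpha beta : int) :
  (alpha <= beta)%R -> lambda R U x beta <= lambda R U x alpha.
Proof.
move=> Hab; apply: ereal_inf_le_tmp => _ [S [Hx HS] <-]; exists S => //; split=> //.
by apply: le_trans HS _; rewrite lee_fin ler_int.
Qed.

Lemma KC_attained x (k : nat) : KC R U x <= k%:R%:E ->
  exists p, [/\ (size p <= k)%N, prints U p [:: x] & KC R U x = (size p)%:R%:E].
Proof.
have [E|[p Hp E]] := @ereal_inf_natP bitseq [set p | prints U p [:: x]] size.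
  by rewrite /KC E leye_eq.
by rewrite /KC E lee_fin ler_nat => Hk; exists p.
Qed.

Lemma KC_le_lambda : universal_prefix_machine U ->
  exists w : nat, forall x alpha, KC R U x <= lambda R U x alpha + w%:R%:E.
Proof.
move=> [Upre Uuniv]; have [V [Vpre HV]] := two_part_machine Upre.
(* The summand 1 pays for rounding log|S| up to [clog]. *)
have [w Hw] := Uuniv V Vpre; exists (size w + 1)%N => x alpha.
rewrite -leeBlDr //; apply: lambda_ge => p s Hp Hx _.
rewrite leeBlDr //; have [z [Hz HVz]] := HV p s x Hp Hx.
apply: (@le_trans _ _ (size (w ++ z))%:R%:E).
  by apply: ereal_inf_lbound; exists (w ++ z) => //; apply/Hw.
rewrite -EFinD lee_fin size_cat Hz !natrD.
by have := clog_le_logb2 (mem_size_undup Hx); lra.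
Qed.

(* The block given by block_machine is the required set.  As the empty program
   diverges, k is at least 2, so that c log k absorbs the constants. *)
Lemma late_program_alpha1 : universal_prefix_machine U ->
  exists2 c : R, (0 <= c)%R & forall x (k i T : nat) p0 q,
    (i < k)%N -> (size p0 <= k)%N -> printed U T p0 = Some [:: x] ->
    (size q <= i)%N -> ~~ halted U T q -> (exists T', halted U T' q) ->
    alpha1 U c x k <= (i%:R + c * logb2 k%:R)%:E.
Proof.
move=> hU; have [_ Uuniv] := hU; have [V [Vpre HV]] := block_machine U.
(* With t = [trunc_log 2 k], l = t + 1 and L = log k, the overhead 3l + 2 + |w| and the 1 in the
   exponent k + 1 - |q| add up to 3t + 6 + |w|. This is at most (9 + |w|)L because t <= L and 1 <=
   L. *)
have [w Hw] := Uuniv V Vpre; exists (9 + size w)%:R%R => //.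
move=> x k i T p0 q ik Hp0 Hx qi qT qT'.
have q0 : (0 < size q)%N.
  case: q qT' {qi qT} => // -[T']; rewrite /halted.
  case E: (run U T' (tree_of_string [::])) => [a|] // _.
  by case: (universal_empty_diverges hU (run_sound E)).
have i0 : (0 < i)%N by apply: leq_trans q0 qi.
have k1 : (1 < k)%N by apply: leq_ltn_trans i0 ik.
pose l := (trunc_log 2 k).+1.
have kl : (k < 2 ^ l)%N by apply: trunc_log_ltn.
have qk : (size q <= k)%N by apply: leq_trans qi (ltnW ik).
have [z [s [Hz HVz Hx' Hs]]] := HV k l T x p0 q kl Hp0 Hx qk qT qT'.
have Hlog : ((trunc_log 2 k)%:R <= logb2 k%:R :> R)%R.
  by rewrite -(logb2_exp2 (trunc_log 2 k)) ler_logb2 ?expn_gt0 // trunc_logP // ltnW.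
have Hlog1 : (1 <= logb2 k%:R :> R)%R.
  by have := @ler_logb2 2 k isT k1; have -> : logb2 2%:R = 1%R :> R := logb2_exp2 1.
pose ov := (3 * l + 2 + size w)%N.
have Hov : (ov%:R + 1 <= (9 + size w)%:R * logb2 k%:R :> R)%R.
  rewrite /ov /l !natrD natrM -addn1 natrD.
  have : (0 <= (size w)%:R :> R)%R by [].
  move: Hlog Hlog1; set L := logb2 _; set t := (trunc_log 2 k)%:R; set b := (size w)%:R.
  by move=> *; nra.
apply: (@le_trans _ _ (i + ov)%:R%:E); last first.
  by rewrite lee_fin natrD lerD2l; lra.
apply: ereal_inf_lbound; exists (Posz (i + ov)) => //=.
have Hwz : prints U (w ++ z) s by apply/Hw.
apply: (le_trans (lambda_le Hwz Hx' _)).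
  by rewrite -[X in (_ <= X)%R]/((i + ov)%:R)%R ler_nat size_cat Hz /ov; lia.
rewrite lee_fin size_cat Hz.
(* The length of [q] in the program and the -|q| in this bound cancel, so only k + 1 + [ov]
   remains. *)
have : (logb2 (size (undup s))%:R <= (k.+1 - size q)%:R :> R)%R.
  rewrite -(logb2_exp2 (k.+1 - size q)); apply: ler_logb2; first exact: mem_size_undup Hx'.
  by apply: leq_trans (size_undup s) Hs.
rewrite natrB ?(leqW qk) // => Hlg.
have E1 : ((size w + (3 * l + 2 + size q))%:R = ov%:R + (size q)%:R :> R)%R.
  by rewrite -natrD /ov; congr _%:R; lia.
have E2 : (k.+1%:R = k%:R + 1 :> R)%R by rewrite -addn1 natrD.
by rewrite E1; move: Hlg Hov; rewrite E2; lra.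
Qed.

Lemma int_leq_natE (z : int) (i : nat) : int_leq_nat z i = (z <= Posz i)%R.
Proof. by case: z. Qed.

End StructureFunction.

(** * Comparing the output with the structure function *)

Section ProfileCloseness.
Context (R : realType) (U : program).

Lemma approx_profile_ge (T : nat) x i n :
  approx_profile U T x i = Some n -> lambda R U x (Posz i) <= n%:R%:E.
Proof.
move=> /approx_profile_attained [p [s [Hp Hs Hx ->]]].
apply: (le_trans (lambda_le (printed_prints Hs) Hx _)); first by rewrite -pmulrn ler_nat.
rewrite lee_fin natrD lerD2l; apply: logb2_le_clog; exact: mem_size_undup Hx.
Qed.

(** When no program of length at most [i] halts after [T], the approximation is final, and its only
    error is the rounding in [clog]. *)
Lemma approx_profile_le_lambda (T : nat) x i :
  (forall q, (size q <= i)%N -> (exists T', halted U T' q) -> halted U T q) ->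
  ereal_of_option R (approx_profile U T x i) <= lambda R U x (Posz i) + 1.
Proof.
move=> H; rewrite -leeBlDr //; apply: lambda_ge => p s Hp Hx.
rewrite -pmulrn ler_nat => pi; rewrite leeBlDr //.
have [T' HT'] := prints_printed Hp.
have HT : halted U T p by apply: H pi _; exists T'; apply: printed_halted HT'.
have [n -> Hn] := approx_profile_le pi (prints_halted_printed Hp HT) Hx.
rewrite /= -EFinD lee_fin; have := clog_le_logb2 R (mem_size_undup Hx).
by move: Hn; rewrite -(ler_nat R) natrD; lra.
Qed.

(** At the switch to the constant k the hypothesis on alpha_0 enters: an earlier value is at least
    lambda_x(i), hence at least lambda_x(alpha_0), hence at least k. *)
Lemma profile_nonincreasing (T : nat) x k (alpha0 : int) i j :
  k%:R%:E <= lambda R U x alpha0 -> (i <= j)%N ->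
  ereal_of_option R (profile U T x k alpha0 j) <= ereal_of_option R (profile U T x k alpha0 i).
Proof.
move=> Hk ij; rewrite /profile !int_leq_natE.
case: (leP alpha0 (Posz i)) => [H0i|Hi0].
  by rewrite (le_trans H0i).
case E: (approx_profile U T x i) => [n|]; last by rewrite /= leey.
case: (leP alpha0 (Posz j)) => [H0j|Hj0].
  apply: (le_trans Hk); apply: le_trans (approx_profile_ge E).
  by apply: lambda_antimono; apply: ltW.
have [p [s [Hp Hs Hx ->]]] := approx_profile_attained E.
have [m -> Hm] := approx_profile_le (leq_trans Hp ij) Hs Hx.
by rewrite lee_fin ler_nat.
Qed.

(** Besides the constant part, j = k qualifies: there [q] competes in the minimum with the list of x
    alone, whose logarithmic size is 0. This covers the case alpha_0 > k. *)
Lemma profile_le (T : nat) x k (alpha0 : int) j q :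
  (size q <= k)%N -> printed U T q = Some [:: x] -> (alpha0 <= Posz j)%R || (j == k) ->
  ereal_of_option R (profile U T x k alpha0 j) <= k%:R%:E.
Proof.
move=> Hq Hx; rewrite /profile int_leq_natE; case: (leP alpha0 (Posz j)) => //= _ /eqP ->.
have [|n -> Hn] := approx_profile_le Hq Hx (x := x); first by rewrite inE.
rewrite lee_fin ler_nat; apply: leq_trans Hn _.
by rewrite /clog /= addn0.
Qed.

Lemma lambda_le_profile (T : nat) x k (alpha0 : int) i (d : R) :
  lambda R U x alpha0 <= (k%:R + d)%:E -> (0 <= d)%R ->
  lambda R U x (Posz i) <= ereal_of_option R (profile U T x k alpha0 i) + d%:E.
Proof.
move=> H d0; rewrite /profile int_leq_natE; case: (leP alpha0 (Posz i)) => [H0|_].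
  by apply: (@le_trans _ _ (lambda R U x alpha0)); [exact: lambda_antimono | rewrite /= -EFinD].
case E: (approx_profile U T x i) => [n|]; last by rewrite /= addye // leey.
by apply: (le_trans (approx_profile_ge E)); rewrite /= -EFinD lee_fin lerDl.
Qed.

(** This settles lambda_x(alpha_0) = +oo. Adding +oo gives +oo unless the supremum is -oo, which is
    excluded by the point [i] of the window and the sign of [g]. *)
Lemma close_on_infinite_delta k (e : \bar R) (f g : nat -> \bar R) :
  0 <= e -> (forall i, 0 <= g i) -> close_on k (fun=> e) (fun=> +oo) f g.
Proof.
move=> e0 g0 i ei ik; split; first by rewrite addeNy leNye.
have wi : window k (fun=> e) i i by split=> //; rewrite subrr normr0.
rewrite addey ?leey // gt_eqF // (@lt_le_trans _ _ 0) //.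
by apply: le_trans (g0 i) _; apply: ereal_sup_ubound; exists i.
Qed.

End ProfileCloseness.

Theorem mainTheorem15 (R : realType) (U : program)
    (hU : universal_prefix_machine U) :
  exists (c C : R) (A : program), (0 <= c)%R /\
    forall (x : bitseq) (k : nat) (alpha0 : int),
      KC R U x <= k%:R%:E -> k%:R%:E <= lambda R U x alpha0 ->
      exists lam : nat -> option nat,
        [/\ halts_with A
              (Node (tree_of_string x)
                 (Node (tree_of_nat k) (tree_of_int alpha0)))
              (tree_of_seq (tree_of_option tree_of_nat) (mkseq lam k.+1)),
            forall i j : nat, (i <= j <= k)%N ->
              ereal_of_option R (lam j) <= ereal_of_option R (lam i)
          & close_on k (fun _ => epsilon_of U c x k alpha0)
                    (fun _ => delta_of U C x alpha0)
                    (fun i => lambda R U x (Posz i))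
                    (fun i => ereal_of_option R (lam i))].
Proof.
have [w Hw] := KC_le_lambda R hU.
have [c c0 Hc] := late_program_alpha1 R hU.
have [A HA] := profile_algorithm U.
(* [w] is the two-part coding constant and 1 the rounding error of the approximation. *)
exists c, (w%:R + 1)%R, A; split=> // x k alpha0 HK Hk.
have [p [Hp Hpx HKp]] := KC_attained HK.
have [T [q [Hq Hx HAx]]] := HA x k alpha0 p Hp Hpx.
exists (profile U T x k alpha0); split=> //.
  by move=> i j /andP[ij _]; apply: profile_nonincreasing.
set e := epsilon_of U c x k alpha0.
have e0 : 0 <= e by rewrite /e /epsilon_of le_max lexx.
rewrite /delta_of HKp.
case ELa : (lambda R U x alpha0) Hk => [La| |] // Hk; last first.
  rewrite /= addye //; apply: close_on_infinite_delta => // i.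
  by case: profile => [n|] /=; rewrite ?lee_fin ?leey.
rewrite -EFinB -EFinD; set d := (La - _ + _)%R.
rewrite lee_fin in Hk.
have HpR : ((size p)%:R <= k%:R :> R)%R by rewrite ler_nat.
have w0 : (0 <= w%:R :> R)%R by [].
have d1 : (1 <= d)%R by rewrite /d; lra.
move=> i ei ik.
have in_window j : (i <= j <= k)%N -> (j%:R - i%:R)%:E <= e -> window k (fun=> e) i j.
  move=> /andP[ij jk] He; split=> //.
    by apply: le_trans ei _; rewrite lee_fin ler_nat.
  by rewrite ger0_norm // subr_ge0 ler_nat.
have wi : window k (fun=> e) i i by apply: in_window; rewrite ?leqnn // subrr.
(* The upper half of closeness holds with j = i; the lower half may require moving to the right. *)
split; last first.
  apply: (@le_trans _ _ (ereal_of_option R (profile U T x k alpha0 i) + d%:E)).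
    by apply: lambda_le_profile; rewrite ?ELa ?lee_fin /d; lra.
  by rewrite leeD2r //; apply: ereal_sup_ubound; exists i.
suff [j wj Hj] : exists2 j, window k (fun=> e) i j &
    ereal_of_option R (profile U T x k alpha0 j) <= lambda R U x (Posz i) + d%:E.
  rewrite leeBlDr //; apply: ge_ereal_inf.
  by exists (ereal_of_option R (profile U T x k alpha0 j)) => //; exists j.
(* Hence every j of the window at which the output is at most k serves for the lower half. *)
have Hlow : k%:R%:E <= lambda R U x (Posz i) + d%:E.
  have := Hw x (Posz i); rewrite HKp.
  case: (lambda R U x (Posz i)) => [l| |] //=; rewrite ?addye ?leey //.
  by rewrite -!EFinD !lee_fin /d; lra.
have [Hi|/norP [Hi0 Hik]] := boolP ((alpha0 <= Posz i)%R || (i == k)).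
  by exists i => //; apply: le_trans Hlow; exact: (profile_le R Hq Hx Hi).
rewrite -ltNge in Hi0.
have ik' : (i < k)%N by rewrite ltn_neqAle Hik.
(* Either the approximation at [i] is already final and j = i works, or a late program [r] bounds
   alpha_1. *)
have [Hall|/existsNP [r /not_implyP [Hr /not_implyP [Hr' /negP Hr'']]]] :=
    pselect (forall r, (size r <= i)%N -> (exists T', halted U T' r) -> halted U T r).
  exists i => //; rewrite /profile int_leq_natE [(alpha0 <= _)%R]leNgt Hi0 /=.
  by apply: le_trans (approx_profile_le_lambda R x Hall) _; rewrite leeD2l // lee_fin.
have Ha1 := Hc x k i T q r ik' Hq Hx Hr Hr'' Hr'.
case: alpha0 Hi0 {HAx ELa wi Hik} @e e0 ei in_window => [n|n] // Hi0 e e0 ei in_window.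
have Hin : (i < n)%N by rewrite -ltz_nat.
(* From alpha_1 <= i + c log k the two terms c log k cancel: n - i <= n - alpha_1 + c log k. *)
have He : (n%:R - i%:R)%:E <= e.
  rewrite /e /epsilon_of le_max; apply/orP; right.
  have -> : ((n%:R - i%:R)%:E : \bar R) =
      n%:R%:E - (i%:R + c * logb2 k%:R)%:E + (c * logb2 k%:R)%:E.
    by rewrite -EFinB -EFinD; congr EFin; ring.
  by apply: leeD2r; apply: leeB.
(* The window ends at k, so alpha_0 is capped there; [profile_le] covers both values of the
   minimum. *)
exists (minn n k).
  apply: in_window; first by rewrite leq_min geq_minr (ltnW Hin) (ltnW ik').
  by apply: le_trans He; rewrite lee_fin lerD2r ler_nat geq_minl.
apply: le_trans Hlow; apply: (profile_le R Hq Hx).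
by rewrite lez_nat /minn; case: ltnP => H; rewrite ?leqnn ?eqxx ?orbT.
Qed.
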